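(* The value function $V:[0,+\infty)\to\mathbb{R}$ satisfies: (i) $V$ is strictly increasing; (ii) for every $k_0>0$ there exist $C(k_0)>0$ and $\delta>0$ such that for every $h\in(-\delta,\delta)$, $h\neq0$, $$\frac{V(k_0+h)-V(k_0)}{h}\ge C(k_0);$$ (iii) $V$ is Lipschitz-continuous in every closed (bounded) sub-interval $[a,b]$ of $(0,+\infty)$.
   Context: Production function: $F:\mathbb{R}\to\mathbb{R}$ is $\mathcal{C}^1$ with $F'>0$ on $\mathbb{R}$, $F(0)=0$, $\lim_{x\to+\infty}F(x)=+\infty$, $L:=\lim_{x\to+\infty}F'(x)>0$; for some $0<\underline{k}<\overline{k}$, $F$ is concave on $[0,\underline{k}]$ and on $[\overline{k},+\infty)$ and convex on $[\underline{k},\overline{k}]$. Utility: $\rho>0$, and $u:[0,+\infty)\to\mathbb{R}$ is strictly increasing and strictly concave, continuous on $[0,+\infty)$ and $\mathcal{C}^2$ on $(0,+\infty)$, with $u(0)=0$, $\lim_{x\to+\infty}u(x)=+\infty$, $\lim_{x\to0^+}u'(x)=+\infty$, $\lim_{x\to+\infty}u'(x)=0$; $\epsilon_0>0$ is a fixed constant with $\lim_{t\to+\infty}e^{\epsilon_0 t}e^{-\rho t}u\left(e^{(L+\epsilon_0)t}\right)=0$. State equation: for $k_0\ge0$ and $c\in\mathcal{L}^1_{loc}([0,+\infty),\mathbb{R})$ (integrable on each bounded interval $[0,T]$), $k(\cdot;k_0,c)$ is the unique (locally absolutely continuous) solution of $k(0)=k_0$, $\dot k(t)=F(k(t))-c(t)$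 for (a.e.) $t\ge0$. Admissible controls: $\Lambda(k_0)$ is the set of $c\in\mathcal{L}^1_{loc}([0,+\infty),\mathbb{R})$ such that $c\ge0$ almost everywhere and $k(\cdot;k_0,c)\ge0$ (i.e. the solution is defined and nonnegative on all of $[0,+\infty)$). Functional and value function: $U(c;k_0):=\int_0^{+\infty}e^{-\rho t}u(c(t))\,dt$ for $c\in\Lambda(k_0)$, and $V:[0,+\infty)\to\mathbb{R}$, $V(k_0):=\sup_{c\in\Lambda(k_0)}U(c;k_0)$. *)

(* Defs.v *)
From HB Require Import structures.
From mathcomp Require Import all_boot all_order all_algebra.
From mathcomp Require Import all_classical all_reals all_analysis.

Set Implicit Arguments.
Unset Strict Implicit.
Unset Printing Implicit Defensive.

Import Order.TTheory GRing.Theory Num.Theory.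
Import numFieldNormedType.Exports.

Local Open Scope ring_scope.
Local Open Scope classical_set_scope.

Definition concave_function (R : realType) (D : set R) (f : R -> R) : Prop :=
  convex_function (D : set R^o) (\- f).

Definition strictly_concave_function (R : realType) (D : set R)
    (f : R -> R) : Prop :=
  forall x y t : R, D x -> D y -> x != y -> 0 < t < 1 ->
    t * f x + (1 - t) * f y < f (t * x + (1 - t) * y).

Record production_function (R : realType) (F : R -> R) (L : R) : Prop := {
  production_derivable : forall x : R, derivable F x 1 ;
  production_derive_continuous : continuous F^`() ;
  production_derive_gt0 : forall x : R, 0 < F^`() x ;
  production0 : F 0 = 0 ;
  production_pinfty : F x @[x --> +oo] --> +oo ;
  production_derive_pinfty : F^`() x @[x --> +oo] --> L ;
  production_slope_gt0 : 0 < L ;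
  production_convexity : exists klow kup : R,
    [/\ 0 < klow < kup,
        concave_function `[0, klow] F,
        convex_function (`[klow, kup]%classic : set R^o) F &
        concave_function `[kup, +oo[ F]
}.

(* [u] is only constrained on [0, +oo[; its values on negative reals are
   irrelevant. *)
Record utility_function (R : realType) (u : R -> R) : Prop := {
  utility_increasing : forall x y : R, 0 <= x -> x < y -> u x < u y ;
  utility_strictly_concave : strictly_concave_function `[0, +oo[ u ;
  utility_continuous : {within `[0, +oo[, continuous u} ;
  utility_derivable : forall x : R, 0 < x -> derivable u x 1 ;
  utility_derivable2 : forall x : R, 0 < x -> derivable u^`() x 1 ;
  utility_derive2_continuous :
    forall x : R, 0 < x -> {for x, continuous u^`(2)} ;
  utility0 : u 0 = 0 ;
  utility_pinfty : u x @[x --> +oo] --> +oo ;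
  utility_derive_0 : u^`() x @[x --> 0^'+] --> +oo ;
  utility_derive_pinfty : u^`() x @[x --> +oo] --> 0
}.

Definition absolutely_continuous (R : realType) (a b : R) (f : R -> R) : Prop :=
  forall e : R, 0 < e -> exists2 d : R, 0 < d &
    forall (n : nat) (x y : 'I_n -> R),
      (forall i, a <= x i /\ x i <= y i /\ y i <= b) ->
      trivIset setT (fun i => `]x i, y i[%classic) ->
      \sum_(i < n) (y i - x i) < d ->
      \sum_(i < n) `|f (y i) - f (x i)| < e.

(* A control is a function on R of which only the values on [0, +oo[ matter. *)
Definition L1loc (R : realType) (c : R -> R) : Prop :=
  forall T : R, 0 <= T -> lebesgue_measure.-integrable `[0, T] (EFin \o c).

Definition state_solution (R : realType) (F : R -> R) (k0 : R) (c k : R -> R)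
    : Prop :=
  [/\ k 0 = k0,
      forall T : R, 0 <= T -> absolutely_continuous 0 T k &
      {ae lebesgue_measure,
        forall t : R, 0 <= t -> is_derive t 1 k (F (k t) - c t)}].

(* The solution of the state equation is unique when [F] is C^1 (locally
   Lipschitz), so the existential quantifier below designates
   k(.; k0, c) and asserts that it is defined on all of [0, +oo[. *)
Definition admissible (R : realType) (F : R -> R) (k0 : R) : set (R -> R) :=
  [set c | [/\ L1loc c,
      {ae lebesgue_measure, forall t : R, 0 <= t -> 0 <= c t} &
      exists2 k : R -> R,
        state_solution F k0 c k & forall t : R, 0 <= t -> 0 <= k t]].

Definition intertemporal_utility (R : realType) (u : R -> R) (rho : R)
    (c : R -> R) : \bar R :=
  (\int[lebesgue_measure]_(t in `[0%R, +oo[) (expR (- rho * t) * u (c t))%:E)%E.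

Definition evalue (R : realType) (F u : R -> R) (rho k0 : R) : \bar R :=
  ereal_sup [set intertemporal_utility u rho c | c in admissible F k0].

(* Real-valued value function; it carries the intended meaning only where
   [evalue] is finite. *)
Definition value (R : realType) (F u : R -> R) (rho k0 : R) : R :=
  fine (evalue F u rho k0).

(* Main.v *)
Require Import Defs.
From HB Require Import structures.
From mathcomp Require Import all_boot all_order all_algebra.
From mathcomp Require Import all_classical all_reals all_analysis.
From mathcomp Require Import measurable_realfun lra ring.

(* Trajectories are never constructed by solving the state equation: a state is
   prescribed and the control is read off as [F k - k'].

   Finiteness: with [lam = L + eps0] one has [F k <= lam k + M], so
   [exp (- lam t) k(t)] controls the discounted consumption
   [int exp (- lam t) c <= k0 + M / lam]; concavity gives
   [u c <= u p (1 + c / p)], used with [p = exp (lam t)].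

   Increase: extra capital [h] can be consumed at rate [h] on [0, 1] while the
   state comes back to the original one. Concavity of [u] and the bound on
   [int_0^1 c] turn this into a gain at least linear in [h], uniformly in [c].

   Lipschitz bound: from [k1], consuming slightly less than production reaches
   [k2] in time [tau = (k2 - k1) / F k1], so [V k1 >= exp (- rho tau) V k2]. *)

Set Implicit Arguments.
Unset Strict Implicit.
Unset Printing Implicit Defensive.

Import Order.TTheory GRing.Theory Num.Theory.
Import numFieldNormedType.Exports.

Local Open Scope ring_scope.
Local Open Scope classical_set_scope.

(** No optimal control is available, so nothing can be read off a maximiser: every comparison is
    made for an arbitrary control, with constants that do not depend on it, and only then passes to
    the supremum. For the gain, the obstacle is that [c] may be huge on [0, 1], where an extra [h]
    brings almost no utility. The bound on its integral forbids this on most of [0, 1], and the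
    threshold [A] is chosen so that the loss is at most half of the gain. The constants are also
    uniform over initial capitals below a given bound; this covers negative increments in (ii),
    whose base point is [k0 + h].

    States solve their equation only almost everywhere, so the differential inequality behind the
    consumption bound is integrated through absolute continuity: an absolutely continuous function
    with almost everywhere nonnegative derivative is nondecreasing. *)

(** * Monotonicity from the sign of an almost everywhere derivative *)

(** The supremum of the points satisfying [P] need not satisfy [P] itself, so the step jumps over
    [t], from a good point just left of it to any point just right of it. *)
Lemma real_induction (R : realType) (P : R -> Prop) (a b : R) :
  a <= b -> P a ->
  (forall t, a <= t <= b -> exists2 r, 0 < r &
     forall x y, a <= x -> t - r < x -> x <= t -> t <= y -> y < t + r ->
       y <= b -> P x -> P y) ->
  P b.
Proof.
move=> ab Pa step.
pose S := [set x | a <= x <= b /\ P x].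
have Sa : S a by split => //; rewrite lexx.
have ubS : ubound S b by move=> x [/andP[]].
have supS : has_sup S by split; [exists a | exists b].
have aS : a <= sup S by apply: ub_le_sup => //; exists b.
have Sb : sup S <= b by apply: ge_sup => //; exists a.
have [r r0 hr] := step (sup S) ltac:(by rewrite aS Sb).
have [x [/andP[ax xb] Px] xS] := sup_adherent r0 supS.
have xS' : x <= sup S by apply: ub_le_sup; [exists b | split => //; rewrite ax].
(* A point satisfying [P] strictly beyond the supremum, unless the supremum is [b]. *)
pose y := Num.min b (sup S + r / 2).
have yS : sup S <= y by rewrite le_min Sb lerDl divr_ge0 // ltW.
have yb : y <= b by rewrite ge_min lexx.
have Py : P y.
  apply: (hr x) => //.
  by rewrite gt_min orbC ltrD2l ltr_pdivrMr // mulrDr mulr1 ltrDl r0.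
have : y <= sup S.
  apply: ub_le_sup; [by exists b | split => //].
  by rewrite yb (le_trans aS yS).
rewrite ge_min gerDl leNgt orbC [_ <= 0]leNgt divr_gt0 //= -leNgt => bS.
have -> // : b = y by apply/eqP; rewrite eq_le yb (le_trans bS yS).
Qed.

Lemma sum_length_le_measure (R : realType) (O : set R) (n : nat)
    (x y : nat -> R) :
  open O ->
  (forall i, (i < n)%N -> x i <= y i /\ `[x i, y i] `<=` O) ->
  (forall i j, (i < j < n)%N -> y i <= x j) ->
  ((\sum_(i < n) (y i - x i))%:E <= lebesgue_measure O)%E.
Proof.
move=> oO xyO yx.
(* The closed intervals may share endpoints; the open ones are disjoint and have the same
   lengths. *)
pose I i := if (i < n)%N then `]x i, y i[%classic else set0.
have mI i : measurable (I i) by rewrite /I; case: ifP.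
have tI : trivIset setT I.
  apply/trivIsetP => i j _ _; wlog ij : i j / (i < j)%N.
    move=> H; rewrite neq_ltn => /orP[ij|ji]; first by apply: H; rewrite // ltn_eqF.
    by rewrite setIC; apply: H; rewrite // ltn_eqF.
  move=> _; rewrite /I; case: ifP => ni; last by rewrite set0I.
  case: ifP => nj; last by rewrite setI0.
  rewrite -subset0 => z [] /=; rewrite !in_itv /= => /andP[_ zy] /andP[xz _].
  have := yx i j; rewrite ij nj => /(_ isT) h.
  by have := lt_trans zy (le_lt_trans h xz); rewrite ltxx.
rewrite -sumEFin.
have -> : (\sum_(i < n) (y i - x i)%:E)%E =
    (\sum_(i < n) lebesgue_measure (I i))%E.
  apply: eq_bigr => i _; rewrite /I ltn_ord lebesgue_measure_itv /= lte_fin.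
  have [xy _] := xyO i (ltn_ord i).
  case: ltP => h; first by rewrite EFinB.
  by have -> : x i = y i; [apply/eqP; rewrite eq_le xy h | rewrite subrr].
have <- := @measure_bigsetU _ _ _ lebesgue_measure I mI tI n.
apply: le_measure; rewrite ?inE.
- by apply: bigsetU_measurable => i _; exact: mI.
- exact: open_measurable.
apply: (big_ind (fun A => A `<=` O)) => //.
- by move=> A B AO BO z [/AO|/BO].
- move=> i _ z; rewrite /I ltn_ord => zi; have [_] := xyO i (ltn_ord i); apply.
  exact: subset_itv_oo_cc zi.
Qed.

(** Straddle lemma: differentiability at the single point [t] controls the increments over small
    intervals containing [t], because such an increment splits at [t]. *)
Lemma is_derive_lower_slope (R : realType) (f : R -> R) (t d e : R) :
  is_derive t 1 f d -> 0 <= d -> 0 < e ->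
  exists2 r, 0 < r & forall x y, t - r < x -> x <= t -> t <= y -> y < t + r ->
    f x - f y <= e * (y - x).
Proof.
move=> fd d0 e0.
have /cvg_ex[/= l] := @ex_derive _ _ _ _ _ _ _ fd.
have := @derive_val _ _ _ _ _ _ _ fd; rewrite /derive => dl cl.
have {dl} ld : l = d by rewrite -dl; apply/esym/cvg_lim.
rewrite {}ld in cl.
have : \forall h \near 0^', `|d - h^-1 *: (f (h *: 1 + t) - f t)| < e.
  by move/cvgrPdist_lt : cl => /(_ _ e0).
move=> /nbhs_ballP[r /= r0 hr]; exists r => //.
have slope h : `|h| < r -> h != 0 ->
    `|d - h^-1 * (f (t + h) - f t)| < e.
  move=> hh h0; have := hr h; rewrite /ball /= sub0r normrN => /(_ hh h0).
  by rewrite /GRing.scale /= mulr1 [h + t]addrC.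
have up y : t <= y -> y < t + r -> f t - f y <= e * (y - t).
  rewrite le_eqVlt => /orP[/eqP <-|ty yr]; first by rewrite !subrr mulr0.
  have yt : 0 < y - t by rewrite subr_gt0.
  have := @slope (y - t); rewrite gtr0_norm // ltrBlDl gt_eqF // => /(_ yr isT).
  rewrite [t + _]addrC subrK ltr_norml => /andP[_].
  set q := _ * _ => hq.
  have -> : f t - f y = - q * (y - t).
    by rewrite /q; field; rewrite gt_eqF.
  by apply: ler_wpM2r; [exact: ltW | lra].
have lo x : t - r < x -> x <= t -> f x - f t <= e * (t - x).
  rewrite [x <= t]le_eqVlt => rx /orP[/eqP ->|xt]; first by rewrite !subrr mulr0.
  have yt : x - t < 0 by rewrite subr_lt0.
  have := @slope (x - t); rewrite ltr0_norm // lt_eqF // => /(_ ltac:(lra) isT).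
  rewrite [t + _]addrC subrK ltr_norml => /andP[_].
  set q := _ * _ => hq.
  have -> : f x - f t = - q * (t - x).
    by rewrite /q; field; rewrite lt_eqF.
  by apply: ler_wpM2r; [rewrite subr_ge0 ltW | lra].
move=> x y rx xt ty yr.
have := lo x rx xt; have := up y ty yr => h1 h2.
have -> : f x - f y = (f x - f t) + (f t - f y) by ring.
have -> : e * (y - x) = e * (t - x) + e * (y - t) by ring.
exact: lerD.
Qed.

Lemma null_set_open_cover (R : realType) (N : set R) (d : R) :
  lebesgue_measure.-negligible N -> 0 < d ->
  exists O : set R, [/\ open O, N `<=` O & (lebesgue_measure O < d%:E)%E].
Proof.
move=> [A [mA A0 NA]] d0.
have [|O [oO AO Od]] := lebesgue_regularity_outer mA _ d0.
  by rewrite [X in (X < _)%E]A0 ltry.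
exists O; split => //; first exact: subset_trans AO.
rewrite -(setDUK AO) measureU //; last by rewrite setDIK.
- by rewrite [X in (X + _)%E]A0 add0e.
- by apply: measurableD => //; exact: open_measurable.
Qed.

(* A null set of exceptional points is covered by an open set of small measure,
   on which absolute continuity bounds the variation of [f]; elsewhere the
   slopes of [f] are locally at least [- e]. *)
Lemma absolutely_continuous_nondecreasing (R : realType) (f : R -> R) (a b : R) :
  a <= b -> absolutely_continuous a b f ->
  {ae lebesgue_measure, forall t, a < t < b ->
     exists2 d : R, 0 <= d & is_derive t 1 f d} ->
  f a <= f b.
Proof.
move=> ab acf aef; rewrite -subr_le0.
have b1a : 0 < b - a + 1 by rewrite ltr_wpDl // subr_ge0.
apply/ler_addgt0Pr => e' e'0; rewrite add0r.
pose e := e' / (b - a + 1); have e0 : 0 < e by rewrite divr_gt0.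
(* The first term pays for the slopes, the second for the variation over the cover. *)
have -> : e' = e * (b - a) + e by rewrite /e; field; rewrite gt_eqF.
have [d d0 hd] := acf e e0.
pose N := ~` [set t | a < t < b -> exists2 d : R, 0 <= d & is_derive t 1 f d].
have aeN : lebesgue_measure.-negligible N by exact: aef.
(* The endpoints are covered too, so that every uncovered [t] lies strictly between [a] and [b],
   where the derivative is known. *)
have negN : lebesgue_measure.-negligible (N `|` [set a] `|` [set b]).
  apply: negligibleU; last by apply/negligibleP => //; exact: lebesgue_measure_set1.
  apply: negligibleU => //.
  by apply/negligibleP => //; exact: lebesgue_measure_set1.
have [U [oU NU Ud]] := null_set_open_cover negN d0.
(* The induction carries a finite ordered chain of intervals inside the cover: the drop of [f] up to
   [z] is paid by slopes and by the variation over the chain. That sum is left unevaluated, since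
   absolute continuity must be applied once, at [b], to the whole chain. *)
pose P z := exists n (x y : nat -> R), [/\
  (forall i, (i < n)%N -> [/\ a <= x i, x i <= y i, y i <= z & `[x i, y i] `<=` U]),
  (forall i j, (i < j < n)%N -> y i <= x j) &
  f a - f z <= e * (z - a) + \sum_(i < n) `|f (y i) - f (x i)|].
suff [n [x [y [xyU yx fab]]]] : P b.
  apply: (le_trans fab); rewrite lerD2l; apply/ltW.
  apply: (hd n (fun i => x i) (fun i => y i)).
  - by move=> i; have [? ? ? _] := xyU i (ltn_ord i).
  - apply/trivIsetP => i j _ _; wlog ij : i j / (i < j)%N.
      move=> H; rewrite neq_ltn => /orP[ij|ji]; first by apply: H; rewrite // -val_eqE /= ltn_eqF.
      by rewrite setIC; apply: H; rewrite // -val_eqE /= ltn_eqF.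
    move=> _; rewrite -subset0 => z [] /=; rewrite !in_itv /= => /andP[_ zy] /andP[xz _].
    have := yx i j; rewrite ij ltn_ord => /(_ isT) h.
    by have := lt_trans zy (le_lt_trans h xz); rewrite ltxx.
  - rewrite -lte_fin; apply: le_lt_trans Ud; apply: sum_length_le_measure => //.
    by move=> i ni; have [] := xyU i ni.
apply: (@real_induction _ P a b) => //.
  exists 0%N, (fun=> 0), (fun=> 0); split => //.
  by rewrite big_ord0 !subrr mulr0 addr0.
move=> t /andP[at_ tb].
have [Ut|nUt] := pselect (U t).
  have /nbhs_ballP[r /= r0 hr] := oU _ Ut.
  exists r => // z w az tz zt tw wt wb [n [x [y [xyU yx fz]]]].
  (* In the cover, the piece from [z] to [w] joins the chain and its variation pays for the drop of
     [f]. *)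
  exists n.+1, (fun i => if (i < n)%N then x i else z),
    (fun i => if (i < n)%N then y i else w); split.
  - move=> i; rewrite ltnS => ni; case: ifP => [ni'|_].
      by have [? ? yz ?] := xyU i ni'; split => //; lra.
    split => //; first lra.
    move=> s /=; rewrite in_itv /= => /andP[zs sw]; apply: hr.
    by rewrite /ball /= ltr_norml; lra.
  - move=> i j /andP[ij]; rewrite ltnS => jn.
    rewrite (leq_trans ij jn); case: ifP => [jn'|_]; first by apply: yx; rewrite ij.
    by have [] := xyU i (leq_trans ij jn).
  - rewrite big_ord_recr /= ltnn.
    rewrite (eq_bigr (fun i : 'I_n => `|f (y i) - f (x i)|)); last first.
      by move=> i _; rewrite ltn_ord.
    have := ler_norm (f z - f w); rewrite distrC.
    have : 0 <= e * (w - z) by apply: mulr_ge0; [exact: ltW | lra].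
    move: fz; rewrite !mulrBr; move: (\sum_(_ < _) _) => S; lra.
have tN : [/\ ~ N t, t <> a & t <> b].
  by split => Nt; apply: nUt; apply: NU; [left; left|left; right|right].
case: tN => /contrapT Nt ta tb'.
have [|l l0 ftl] := Nt.
  rewrite !lt_neqAle at_ tb !andbT; apply/andP; split; apply/eqP => //.
  by move=> h; apply: ta.
have [r r0 hr] := is_derive_lower_slope ftl l0 e0.
exists r => // z w az tz zt tw wt wb [n [x [y [xyU yx fz]]]].
exists n, x, y; split => //.
  by move=> i ni; have [? ? yz ?] := xyU i ni; split => //; lra.
have := hr z w tz zt tw wt.
move: fz; rewrite !mulrBr; move: (\sum_(_ < _) _) => S; lra.
Qed.

(** * Closure properties of absolute continuity *)

Section absolutely_continuous_theory.
Context {R : realType}.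
Implicit Types (f g : R -> R) (a b : R).

Lemma absolutely_continuous_eq a b f g :
  (forall t, a <= t <= b -> f t = g t) ->
  absolutely_continuous a b f -> absolutely_continuous a b g.
Proof.
move=> fg acf e e0; have [d d0 hd] := acf e e0.
exists d => // n x y xy txy sxy.
rewrite (eq_bigr (fun i => `|f (y i) - f (x i)|)); first exact: hd.
by move=> i _; have [? [? ?]] := xy i; rewrite !fg //; apply/andP; split; lra.
Qed.

Lemma lipschitz_absolutely_continuous a b f (C : R) :
  (forall x y, a <= x -> x <= y -> y <= b -> `|f y - f x| <= C * (y - x)) ->
  absolutely_continuous a b f.
Proof.
(* A positive majorant of [C], which may be zero or negative, to divide by. *)
move=> lf e e0; pose K := Num.max C 0 + 1.
have K0 : 0 < K by rewrite ltr_wpDl // le_max lexx orbT.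
exists (e / K); first by rewrite divr_gt0.
move=> n x y xy _; rewrite ltr_pdivlMr // => /(le_lt_trans _); apply.
rewrite mulr_suml; apply: ler_sum => i _; have [ax [xyi yb]] := xy i.
apply: le_trans (lf _ _ ax xyi yb) _; rewrite mulrC ler_wpM2l ?subr_ge0 //.
by rewrite /K (le_trans (_ : _ <= Num.max C 0)) ?lerDl // le_max lexx.
Qed.

Lemma absolutely_continuousD a b f g :
  absolutely_continuous a b f -> absolutely_continuous a b g ->
  absolutely_continuous a b (f \+ g).
Proof.
move=> acf acg e e0; have e20 : 0 < e / 2 by rewrite divr_gt0.
have [d d0 hd] := acf _ e20; have [d' d'0 hd'] := acg _ e20.
exists (Num.min d d'); first by rewrite lt_min d0.
move=> n x y xy txy; rewrite lt_min => /andP[sd sd'].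
rewrite [e in _ < e](splitr e).
apply: le_lt_trans (ltrD (hd n x y xy txy sd) (hd' n x y xy txy sd')).
rewrite -big_split /=; apply: ler_sum => i _.
by rewrite opprD addrACA ler_normD.
Qed.

Lemma absolutely_continuousM a b f g (M : R) :
  (forall t, a <= t <= b -> `|f t| <= M) ->
  (forall t, a <= t <= b -> `|g t| <= M) ->
  absolutely_continuous a b f -> absolutely_continuous a b g ->
  absolutely_continuous a b (f \* g).
Proof.
move=> fM gM acf acg e e0; pose K := Num.max M 0 + 1.
have K0 : 0 < K by rewrite ltr_wpDl // le_max lexx orbT.
have MK : M <= K by rewrite /K (le_trans (_ : _ <= Num.max M 0)) ?lerDl // le_max lexx.
have e20 : 0 < e / 2 / K by rewrite !divr_gt0.
have [d d0 hd] := acf _ e20; have [d' d'0 hd'] := acg _ e20.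
exists (Num.min d d'); first by rewrite lt_min d0.
move=> n x y xy txy; rewrite lt_min => /andP[sd sd'].
have -> : e = (e / 2 / K + e / 2 / K) * K by field; rewrite gt_eqF.
have := ltrD (hd n x y xy txy sd) (hd' n x y xy txy sd').
rewrite -(ltr_pM2r K0); apply: le_lt_trans.
rewrite -big_split /= mulr_suml; apply: ler_sum => i _.
have [ax [xyi yb]] := xy i.
have -> : f (y i) * g (y i) - f (x i) * g (x i) =
  (f (y i) - f (x i)) * g (y i) + (g (y i) - g (x i)) * f (x i) by ring.
rewrite (le_trans (ler_normD _ _)) // !normrM mulrDl lerD //.
- by rewrite ler_wpM2l // (le_trans (gM _ _)) //; apply/andP; split; lra.
- by rewrite ler_wpM2l // (le_trans (fM _ _)) //; apply/andP; split; lra.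
Qed.

(** The clamped shift is nondecreasing and 1-Lipschitz, so it sends disjoint intervals to disjoint
    intervals of no larger total length. *)
Lemma absolutely_continuous_delay f (T s : R) : 0 <= s ->
  absolutely_continuous 0 T f ->
  absolutely_continuous 0 T (fun t => f (Num.max (t - s) 0)).
Proof.
move=> s0 acf e e0; have [d d0 hd] := acf _ e0.
exists d => // n x y xy txy sxy.
have mx t u : t <= u -> Num.max (t - s) 0 <= Num.max (u - s) 0.
  by move=> tu; rewrite ge_max !le_max lexx lerB // orbT.
apply: (hd n (fun i => Num.max (x i - s) 0) (fun i => Num.max (y i - s) 0)).
- move=> i; have [x0 [xyi yT]] := xy i; split; first by rewrite le_max lexx orbT.
  split; first exact: mx.
  by rewrite ge_max; apply/andP; split; lra.
- move=> i j _ _ [z [] /=]; rewrite !in_itv /= => zi zj; apply: txy => //.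
  exists (z + s); split; rewrite /= in_itv /=.
  + move: zi; rewrite gt_max lt_max => /andP[/andP[h1 h2] /orP[|]]; lra.
  + move: zj; rewrite gt_max lt_max => /andP[/andP[h1 h2] /orP[|]]; lra.
- apply: le_lt_trans sxy; apply: ler_sum => i _; have [x0 [xyi yT]] := xy i.
  by rewrite /Num.max; do 2 case: ifPn; rewrite -?leNgt; lra.
Qed.

Lemma absolutely_continuous_dist a b f (e : R) :
  absolutely_continuous a b f -> 0 < e -> exists2 d, 0 < d &
  forall x y, a <= x <= b -> a <= y <= b -> `|x - y| < d -> `|f x - f y| < e.
Proof.
move=> acf e0; have [d d0 hd] := acf _ e0; exists d => // x y.
wlog xy : x y / x <= y => [H|].
  case: (leP x y) => [|/ltW yx] hx hy; first exact: H.
  by rewrite distrC [X in _ -> X < _]distrC; exact: H.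
move=> /andP[ax xb] /andP[ay yb]; rewrite distrC ger0_norm ?subr_ge0 // => xyd.
have := hd 1%N (fun=> x) (fun=> y); rewrite !big_ord1 distrC; apply => //.
by apply/trivIsetP => i j; rewrite !ord1 eqxx.
Qed.

Lemma continuous_extend0 f :
  (forall T, 0 <= T -> absolutely_continuous 0 T f) ->
  continuous (fun t : R => f (Num.max t 0)).
Proof.
move=> acf t; apply/cvgrPdist_lt => e e0.
pose T := `|t| + 1.
have T0 : 0 <= T by rewrite addr_ge0.
have [d d0 hd] := absolutely_continuous_dist (acf T T0) e0.
near=> s; apply: hd.
- by rewrite le_max lexx orbT ge_max T0 andbT /T ler_wpDr // ler_norm.
- rewrite le_max lexx orbT ge_max T0 andbT /T /=.
  have : `|t - s| < 1 by near: s; apply: cvgr_dist_lt => //; exact: cvg_id.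
  by have := ler_norm t; rewrite ltr_norml; lra.
- have : `|t - s| < d by near: s; apply: cvgr_dist_lt => //; exact: cvg_id.
  rewrite !ltr_norml /Num.max; do 2 case: ifPn; rewrite -?leNgt; lra.
Unshelve. all: by end_near. Qed.

End absolutely_continuous_theory.

(** * Translation invariance of Lebesgue measure *)

Section translation.
Context {R : realType}.
Local Notation mu := (@lebesgue_measure R).

Lemma measurable_shift (s : R) :
  measurable_fun setT ((fun t => t - s) : measurableTypeR R -> measurableTypeR R).
Proof. by apply: measurable_funB. Qed.

(** Uniqueness of Lebesgue measure: its image under a translation gives half-open intervals their
    length. *)
Lemma lebesgue_measure_shift (s : R) (A : set R) : measurable A ->
  mu ((fun t => t - s) @^-1` A) = mu A.
Proof.
move=> mA; rewrite -[LHS]/(pushforward mu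
  ((fun t => t - s) : measurableTypeR R -> measurableTypeR R) A).
apply/esym/lebesgue_measure_unique => //= [|_ _ [[a b]] _ <-].
  exact: measurable_shift.
rewrite /pushforward.
have -> : (fun t : R => t - s) @^-1` `]a, b] = `]a + s, b + s].
  by apply/seteqP; split => z /=; rewrite !in_itv /= ltrBrDr lerBlDr.
rewrite !lebesgue_measure_itv /= !lte_fin ltrD2r; case: ifP => // _.
by rewrite -!EFinB; congr EFin; ring.
Qed.

Lemma ge0_integral_shift (s : R) (D : set R) (f : R -> \bar R) :
  measurable D -> measurable_fun D f -> (forall t, D t -> (0 <= f t)%E) ->
  (\int[mu]_(t in (fun t => (t - s)%R) @^-1` D) f (t - s)%R = \int[mu]_(t in D) f t)%E.
Proof.
move=> mD mf f0.
rewrite -(@ge0_integral_pushforward _ _ _ _ _ _ (measurable_shift s) mu D f) //.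
  apply: eq_measure_integral => //= [|? A mA AS].
    exact: measurable_shift.
  exact: lebesgue_measure_shift.
by move=> t; rewrite inE; exact: f0.
Qed.

Lemma ae_shift (s : R) (P : R -> Prop) :
  {ae mu, forall t, P t} -> {ae mu, forall t, P (t - s)}.
Proof.
move=> [N [mN N0 PN]]; exists ((fun t => t - s) @^-1` N); split.
- by rewrite -[X in measurable X]setTI; exact: measurable_shift.
- by rewrite -[RHS]N0; exact: lebesgue_measure_shift.
- by move=> t /= Pt; exact: PN.
Qed.

End translation.

(** * Integrals of possibly non-measurable functions that agree off a null set *)

Section integral_null_set.
Context d (T : measurableType d) (R : realType) (mu : {measure set T -> \bar R}).
Local Open Scope ereal_scope.
Import HBNNSimple.

(** The integral of a nonnegative function is the supremum over the simple functions below it.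
    Setting such a function to zero on [N] keeps its integral and puts it below [g]. *)
Let ge0_le_integral_off_null (N : set T) (f g : T -> \bar R) :
  measurable N -> mu N = 0 -> (forall t, 0 <= f t) -> (forall t, 0 <= g t) ->
  (forall t, ~ N t -> f t = g t) ->
  \int[mu]_t f t <= \int[mu]_t g t.
Proof.
move=> mN N0 f0 g0 fg.
rewrite [in X in X <= _]ge0_integralTE //; apply: ge_ereal_sup => _ /= [h hf <-].
pose h' := proj_nnsfun h (measurableC mN).
have -> : sintegral mu h = sintegral mu h'.
  rewrite -!integralT_nnsfun; apply: ge0_ae_eq_integral => //.
  - by apply/measurable_EFinP; exact: measurable_funP.
  - by apply/measurable_EFinP; exact: measurable_funP.
  - by move=> t _; rewrite lee_fin.
  - by move=> t _; rewrite lee_fin.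
  exists N; split => // t /=; apply: contra_notP => Nt _.
  by rewrite /h' /= mindicE mem_set // mulr1.
rewrite ge0_integralTE //; apply: ereal_sup_ubound; exists h' => // t.
rewrite /h' /= mindicE; case: (pselect (N t)) => Nt.
  by rewrite memNset ?mulr0 //= => /(_ Nt).
by rewrite mem_set // mulr1 -fg.
Qed.

(* Measurability is not assumed because [u] is arbitrary on negative reals, so
   that [u \o c] need not be measurable when [c] is only a.e. nonnegative. *)
Lemma eq_integral_off_null (D N : set T) (f g : T -> \bar R) :
  measurable N -> mu N = 0 -> (forall t, D t -> ~ N t -> f t = g t) ->
  \int[mu]_(t in D) f t = \int[mu]_(t in D) g t.
Proof.
move=> mN N0 fg; rewrite integral_mkcond [RHS]integral_mkcond.
have {}fg t : ~ N t -> (f \_ D) t = (g \_ D) t.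
  by move=> Nt; rewrite !patchE; case: ifPn => // /set_mem Dt; exact: fg.
rewrite integralE [RHS]integralE; congr (_ - _); apply/eqP; rewrite eq_le.
  by apply/andP; split; apply: (ge0_le_integral_off_null mN N0) => // t Nt;
    rewrite !funeposE fg.
by apply/andP; split; apply: (ge0_le_integral_off_null mN N0) => // t Nt;
  rewrite !funenegE fg.
Qed.

End integral_null_set.

(* An admissible control normalised on null sets and on negative times, so that
   the control is measurable and the state continuous on the whole line. *)
Record trajectory (R : realType) (F : R -> R) (k0 : R) (c k : R -> R) : Prop := {
  trajectory_measurable : measurable_fun setT c ;
  trajectory_control_ge0 : forall t, 0 <= c t ;
  trajectory_control_neg : forall t : R, t < 0 -> c t = 0 ;
  trajectory_L1loc : L1loc c ;
  trajectory_continuous : continuous k ;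
  trajectory_initial : k 0 = k0 ;
  trajectory_state_ge0 : forall t, 0 <= k t ;
  trajectory_ac : forall T : R, 0 <= T -> absolutely_continuous 0 T k ;
  trajectory_ode : {ae lebesgue_measure,
    forall t : R, 0 < t -> is_derive t 1 k (F (k t) - c t)}
}.

(** Discards the instants where a glued state may fail to be differentiable: time 0 for a normalised
    state, the end of the ramp, the end of the delay. *)
Lemma ae_neq (R : realType) (a : R) : {ae lebesgue_measure, forall t : R, t != a}.
Proof.
exists [set a]; split => //; first exact: lebesgue_measure_set1.
by move=> t /= /negP; rewrite negbK => /eqP.
Qed.

Lemma trajectory_admissible (R : realType) (F : R -> R) k0 c k :
  trajectory F k0 c k -> admissible F k0 c.
Proof.
case=> mc c0 _ Lc _ k_0 kge0 kac kode; split => //.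
- by apply: aeW => t _; exact: c0.
- exists k => //; split => //.
  have := @ae_neq R 0; move: kode; apply: filterS2 => [|t kt t0 t_ge0].
    exact: (ae_filter_ringOfSetsType lebesgue_measure).
  by apply: kt; rewrite lt_neqAle eq_sym t0.
Qed.

Lemma admissible_trajectory (R : realType) (F u : R -> R) rho k0 c :
  admissible F k0 c -> exists c' k', trajectory F k0 c' k' /\
    intertemporal_utility u rho c = intertemporal_utility u rho c'.
Proof.
move=> [Lc c0 [k [k_0 kac kode] kge0]].
(* On [0, +oo[ this changes [c] only on the null set where it is negative, so the utility integral
   is the same. *)
pose c' := (fun t => Num.max (c t) 0) \_ `[0, +oo[.
pose k' t := k (Num.max t 0).
have c'E t : 0 <= t -> c' t = Num.max (c t) 0.
  by move=> t0; rewrite /c' patchE mem_set //= in_itv /= t0.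
have mc' : measurable_fun setT c'.
  apply/(measurable_restrictT (fun t => Num.max (c t) 0)) => //.
  apply: measurable_maxr; last exact: measurable_cst.
  rewrite itv_bndy_bigcup_BRight; apply/measurable_fun_bigcup => // n.
  have /Lc /measurable_int : 0 <= 0 + n%:R :> R by rewrite add0r.
  by move/measurable_EFinP.
have c'0 t : 0 <= c' t.
  by rewrite /c' patchE; case: ifP => // _; rewrite le_max lexx orbT.
exists c', k'; split; last first.
  have [N [mN N0 cN]] := c0.
  apply: (eq_integral_off_null mN N0) => t /=; rewrite in_itv /= andbT => t0 Nt.
  rewrite c'E //; congr ((_ * u _)%:E); apply/esym/max_idPl.
  by apply: contrapT => ct; apply: Nt; apply: cN => /= /(_ t0).
split => //.
- by move=> t t0; rewrite /c' patchE memNset //= in_itv /= andbT leNgt t0.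
- move=> T T0; apply: le_integrable (Lc T T0) => //.
    by apply/measurable_EFinP; exact: measurable_funTS.
  move=> t /=; rewrite in_itv /= => /andP[t0 _].
  rewrite c'E // lee_fin ger0_norm ?le_max ?lexx ?orbT //.
  by rewrite ge_max ler_norm normr_ge0.
- exact: continuous_extend0.
- by rewrite /k' maxxx.
- by move=> t; apply: kge0; rewrite le_max lexx orbT.
- move=> T T0; apply: absolutely_continuous_eq (kac T T0) => t /andP[t0 _].
  by rewrite /k' max_l.
- move: c0 kode; apply: filterS2 => [|t ct kt t0].
    exact: (ae_filter_ringOfSetsType lebesgue_measure).
  have := kt (ltW t0); rewrite c'E ?ltW // max_l ?ct ?ltW //.
  rewrite {2}/k' max_l ?ltW //; apply: near_eq_is_derive.
  near=> s; rewrite /k' max_l //; apply/ltW; near: s.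
  exact: lt_nbhsr.
Unshelve. all: by end_near. Qed.

(** * The value as a supremum over normalised trajectories *)

Section value_as_supremum.
Context (R : realType) (F u : R -> R) (rho : R).

Lemma evalue_ge k0 c k : trajectory F k0 c k ->
  (intertemporal_utility u rho c <= evalue F u rho k0)%E.
Proof.
by move=> tr; apply: ereal_sup_ubound; exists c => //; exact: trajectory_admissible tr.
Qed.

Lemma evalue_le k0 x :
  (forall c k, trajectory F k0 c k -> (intertemporal_utility u rho c <= x)%E) ->
  (evalue F u rho k0 <= x)%E.
Proof.
move=> H; apply: ge_ereal_sup => _ [c /(admissible_trajectory u rho)[c' [k' [tr ->]]] <-].
exact: H tr.
Qed.

End value_as_supremum.

(** * Monotonicity and affine growth of [F] *)

Section production_function_theory.
Context (R : realType) (F : R -> R) (L : R).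
Hypothesis hF : production_function F L.

Lemma production_is_derive (x : R) : is_derive x 1 F (F^`() x).
Proof. by rewrite derive1E; apply: derivableP; exact: (production_derivable hF). Qed.

Lemma production_continuous : continuous F.
Proof.
move=> x; apply: differentiable_continuous.
by apply/derivable1_diffP; exact: (production_derivable hF).
Qed.

Lemma production_MVT (x y : R) : x < y ->
  exists2 z, x < z < y & F y - F x = (F^`())%classic z * (y - x).
Proof.
move=> xy; have [||z] := @MVT _ F F^`() x y xy.
- by move=> z _; exact: production_is_derive.
- by apply: continuous_subspaceT; exact: production_continuous.
- by rewrite in_itv /= => zxy ->; exists z.
Qed.

Lemma production_lt (x y : R) : x < y -> F x < F y.
Proof.
move=> xy; have [z _] := production_MVT xy; rewrite -subr_gt0 => ->.
by rewrite mulr_gt0 ?subr_gt0 // (production_derive_gt0 hF).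
Qed.

Lemma production_le (x y : R) : x <= y -> F x <= F y.
Proof. by rewrite le_eqVlt => /orP[/eqP -> //|/production_lt/ltW]. Qed.

Lemma production_ge0 (x : R) : 0 <= x -> 0 <= F x.
Proof. by move=> x0; rewrite -(production0 hF); exact: production_le. Qed.

Lemma production_gt0 (x : R) : 0 < x -> 0 < F x.
Proof. by move=> x0; rewrite -[X in X < _](production0 hF); exact: production_lt. Qed.

(** Beyond some [x1] the slope of [F] stays below [L + eps], and up to [x1] monotonicity bounds [F]
    by [F x1], which serves as [M]. *)
Lemma production_affine_bound (eps : R) : 0 < eps ->
  exists2 M, 0 <= M & forall x, 0 <= x -> F x <= (L + eps) * x + M.
Proof.
move=> eps0; have Leps : 0 < L + eps.
  by rewrite addr_gt0 // (production_slope_gt0 hF).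
have : \forall x \near +oo, F^`() x < L + eps.
  apply: (cvgr_lt L (production_derive_pinfty hF)); by rewrite ltrDl.
move=> [x0 [_ hx0]]; pose x1 := Num.max x0 0.
have x10 : 0 <= x1 by rewrite le_max lexx orbT.
exists (F x1); first exact: production_ge0.
move=> x xge0; have [xx1|x1x] := leP x x1.
  by apply: ler_wpDl; [apply: mulr_ge0 => //; exact: ltW | exact: production_le].
have [z /andP[x1z zx]] := production_MVT x1x.
have /ltW h : F^`() z < L + eps by apply: hx0; rewrite (le_lt_trans _ x1z) // le_max lexx.
have h1 : (F^`())%classic z * (x - x1) <= (L + eps) * (x - x1) by rewrite ler_wpM2r // subr_ge0 ltW.
have : 0 <= (L + eps) * x1 by rewrite mulr_ge0 // ltW.
rewrite mulrBr in h1; lra.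
Qed.

End production_function_theory.

Section exponential_decay.
Context {R : realType}.
Implicit Types l t : R.

Lemma expR_decay_le1 l t : 0 <= l -> 0 <= t -> expR (- l * t) <= 1.
Proof. by move=> l0 t0; rewrite -expR0 ler_expR mulNr oppr_le0 mulr_ge0. Qed.

Lemma expR_decay_lipschitz l (x y : R) : 0 <= l -> 0 <= x -> x <= y ->
  0 <= expR (- l * x) - expR (- l * y) <= l * (y - x).
Proof.
move=> l0 x0 xy; apply/andP; split.
  by rewrite subr_ge0 ler_expR !mulNr lerN2 ler_wpM2l.
have -> : - l * y = - l * x + - l * (y - x) by ring.
rewrite expRD -[X in X - _]mulr1 -mulrBr.
have h : 1 - expR (- l * (y - x)) <= l * (y - x).
  by have := expR_ge1Dx (- l * (y - x)); lra.
apply: le_trans h; rewrite ler_piMl ?expR_decay_le1 //.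
by rewrite subr_ge0 expR_decay_le1 // subr_ge0.
Qed.

Lemma is_derive_expR_linear l t : is_derive t 1 (fun s => expR (l * s)) (l * expR (l * t)).
Proof.
have h : is_derive t 1 (fun s => l * s) l.
  have := @is_deriveZ _ _ _ id l t 1 1 (is_derive_id _ _); rewrite /GRing.scale /= mulr1; exact.
by have := is_derive1_comp (is_derive_expR (l * t)) h; rewrite mulrC.
Qed.

Lemma measurable_expR_linear l : measurable_fun setT (fun t => expR (l * t)).
Proof.
apply: continuous_measurable_fun => t; apply: differentiable_continuous.
by apply/derivable1_diffP; case: (is_derive_expR_linear l t).
Qed.

End exponential_decay.

(** * Bound on discounted consumption along a trajectory *)

Section a_priori_estimate.
Context (R : realType) (F : R -> R) (lam M : R).
Hypotheses (lam0 : 0 < lam) (M0 : 0 <= M).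
Hypothesis FM : forall x, 0 <= x -> F x <= lam * x + M.
Context (k0 : R) (c k : R -> R).
Hypothesis tr : trajectory F k0 c k.
Local Notation mu := (@lebesgue_measure R).

(** Truncating consumption at [n] makes the running integral [G n] Lipschitz, hence absolutely
    continuous. The bound obtained is independent of [n], so monotone convergence removes the
    truncation. *)
Let g (n : nat) (s : R) := expR (- lam * s) * Num.min (c s) n%:R.

Let g_ge0 n s : 0 <= g n s.
Proof. by rewrite mulr_ge0 ?expR_ge0 // le_min (trajectory_control_ge0 tr) ler0n. Qed.

Let g_le n s : g n s <= n%:R.
Proof.
have [s0|s0] := leP 0 s.
  have := expR_decay_le1 (ltW lam0) s0 => e1.
  rewrite (le_trans (_ : _ <= Num.min (c s) n%:R)) ?ge_min ?lexx ?orbT //.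
  by rewrite ler_piMl // le_min (trajectory_control_ge0 tr) ler0n.
by rewrite /g (trajectory_control_neg tr) // min_l // mulr0.
Qed.

Let g_measurable n : measurable_fun setT (g n).
Proof.
apply: measurable_funM; first exact: measurable_expR_linear.
by apply: measurable_minr => //; exact: trajectory_measurable tr.
Qed.

Let g_integrable n (A : set R) : measurable A -> (mu A < +oo)%E ->
  mu.-integrable A (EFin \o g n).
Proof.
move=> mA Aoo; apply: measurable_bounded_integrable => //.
  exact: measurable_funTS (g_measurable n).
exists n%:R; split => // x nx z _; apply: le_trans (ltW nx).
by rewrite ger0_norm.
Qed.

Let itv_finite (a b : R) (b0 b1 : bool) :
  (mu [set` Interval (BSide b0 a) (BSide b1 b)] < +oo)%E.
Proof. by rewrite lebesgue_measure_itv /=; case: ifP => _; rewrite ?ltry // -EFinB ltry. Qed.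

Let G n (t : R) : R := (\int[mu]_(s in `[0, t]) g n s)%R.

Let G_lipschitz n (x y : R) : 0 <= x -> x <= y -> 0 <= G n y - G n x <= n%:R * (y - x).
Proof.
move=> x0 xy.
have -> : G n y - G n x = (\int[mu]_(s in `]x, y]) g n s)%R.
  apply: Rintegral_itvB; first exact: g_integrable.
  - by rewrite bnd_simp.
  - by rewrite bnd_simp.
apply/andP; split; first by apply: Rintegral_ge0 => s _; exact: g_ge0.
apply: (@le_trans _ _ (\int[mu]_(s in `]x, y]) n%:R)%R).
  apply: le_Rintegral => //; first exact: g_integrable.
  apply: measurable_bounded_integrable => //; first exact: itv_finite.
  by exists n%:R; split => // z nz s _ /=; rewrite ger0_norm ?ler0n // ltW.
rewrite Rintegral_cst //= lebesgue_measure_itv /= lte_fin.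
case: ltP => h; rewrite -?EFinB //=.
by have -> : x = y by [apply/eqP; rewrite eq_le xy h]; rewrite subrr.
Qed.

Let G_derive n : {ae mu, forall t : R, 0 < t -> is_derive t 1 (G n) (g n t)}.
Proof.
have loc : locally_integrable setT (g n).
  split; [exact: g_measurable|exact: openT|move=> K _ cK].
  have /integrableP[_] := g_integrable n (compact_measurable cK) (compact_finite_measure cK).
  exact.
have := FTC1 (a := BLeft 0)
  (fun y => g_integrable n (measurable_itv _) (itv_finite 0 y true false)) loc.
apply: filterS => [|t h t0]; first exact: (ae_filter_ringOfSetsType mu).
have [|dG <-] := h; first by rewrite lte_fin.
by rewrite derive1E; exact: derivableP.
Qed.

(** With [E] the discount factor, [- E k - G n - (M / lam) E] has almost everywhere the derivative
    [E (lam k + M - F k + (c - min c n))], nonnegative by [FM]. Comparing the values at 0 and [T]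
    gives the bound. *)
Let G_bound n (T : R) : 0 <= T -> G n T <= k0 + M / lam.
Proof.
move=> T0; pose E (t : R) := expR (- lam * t).
pose h t := - G n t - M / lam * E t.
have Ml : 0 <= M / lam by rewrite divr_ge0 // ltW.
have ach : absolutely_continuous 0 T h.
  apply: (@lipschitz_absolutely_continuous _ _ _ _ (n%:R + M)) => x y x0 xy _.
  have /andP[h1 h2] := G_lipschitz n x0 xy.
  have /andP[h3 h4] := expR_decay_lipschitz (ltW lam0) x0 xy.
  rewrite /h ler_norml; apply/andP; split.
    have : 0 <= M * (y - x) by rewrite mulr_ge0 // subr_ge0.
    have : 0 <= M / lam * (E x - E y) by rewrite mulr_ge0.
    rewrite mulrDl mulrBr; lra.
  have : M / lam * (E x - E y) <= M * (y - x).
    have -> : M * (y - x) = M / lam * (lam * (y - x)) by field; rewrite gt_eqF.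
    by rewrite ler_wpM2l.
  have : 0 <= n%:R * (y - x) by rewrite mulr_ge0 // subr_ge0.
  rewrite mulrDl mulrBr; lra.
have acE : absolutely_continuous 0 T (fun t => - E t).
  apply: (@lipschitz_absolutely_continuous _ _ _ _ lam) => x y x0 xy _.
  have /andP[h3 h4] := expR_decay_lipschitz (ltW lam0) x0 xy.
  by rewrite opprK addrC ger0_norm.
(* A product of absolutely continuous functions needs bounded factors; continuity of [k] on a
   compact interval supplies the bound. *)
have [z zT kz] : exists2 z, z \in `[0, T]%R & forall t, t \in `[0, T]%R -> k t <= k z.
  apply: EVT_max => //; apply: continuous_subspaceT; exact: trajectory_continuous tr.
have acEk : absolutely_continuous 0 T ((fun t => - E t) \* k).
  apply: (absolutely_continuousM (M := 1 + k z)) => //; last exact: trajectory_ac tr _ T0.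
  - move=> t /andP[t0 _]; rewrite normrN ger0_norm ?expR_ge0 //.
    have := expR_decay_le1 (ltW lam0) t0; have := trajectory_state_ge0 tr z.
    rewrite /E; lra.
  - move=> t tT; rewrite ger0_norm ?(trajectory_state_ge0 tr) //.
    by have := kz t; rewrite in_itv /= => /(_ tT); lra.
have := absolutely_continuous_nondecreasing T0 (absolutely_continuousD acEk ach).
have aed : {ae mu, forall t : R, 0 < t < T -> exists2 d : R, 0 <= d &
    is_derive t 1 ((fun t => - E t) \* k \+ h) d}.
  move: (trajectory_ode tr) (G_derive n); apply: filterS2 => [|t kt Gt /andP[t0 _]].
    exact: (ae_filter_ringOfSetsType mu).
  have {}kt := kt t0; have {}Gt := Gt t0.
  have Et := is_derive_expR_linear (- lam) t.
  exists (E t * (lam * k t + M - F (k t) + (c t - Num.min (c t) n%:R))).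
    rewrite mulr_ge0 ?expR_ge0 // addr_ge0 //.
      by rewrite subr_ge0 FM // (trajectory_state_ge0 tr).
    by rewrite subr_ge0 ge_min lexx.
  have -> : (fun t => - E t) \* k \+ h =
      (- (fun s => expR (- lam * s))) * k - G n - (M / lam) *: (fun s : R => expR (- lam * s)).
    by apply/funext => s; rewrite /h /E /=  addrA.
  apply: is_derive_eq; rewrite [X in X *: (F _ - _)](_ : _ = - E t) //.
  rewrite /g /GRing.scale /= /E; field.
  by rewrite gt_eqF.
move=> /(_ aed) /=; rewrite /h /E.
rewrite (_ : G n 0 = 0); last by rewrite /G set_itv1 Rintegral_set1.
rewrite mulr0 expR0 (trajectory_initial tr).
have : 0 <= expR (- lam * T) * k T by rewrite mulr_ge0 ?expR_ge0 // (trajectory_state_ge0 tr).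
have : 0 <= M / lam * expR (- lam * T) by rewrite mulr_ge0 ?expR_ge0.
lra.
Qed.

Lemma trajectory_discounted_consumption :
  (\int[mu]_(t in `[0%R, +oo[) (expR (- lam * t) * c t)%:E <= (k0 + M / lam)%:E)%E.
Proof.
(* Both the rate of consumption and the horizon are cut at [n]; once [n] exceeds [t] and [c t], the
   sequence is constant at [t]. *)
pose gT (n : nat) : R -> \bar R := (fun t => (g n t)%:E) \_ `[0%R, n%:R].
have gTnd t : {homo gT^~ t : n m / (n <= m)%N >-> (n <= m)%E}.
  move=> n m nm; rewrite /gT !patchE; case: ifPn => [|_].
    rewrite inE /= in_itv /= => /andP[t0 tn]; rewrite mem_set /=; last first.
      by rewrite in_itv /= t0 (le_trans tn) // ler_nat.
    rewrite lee_fin /g ler_wpM2l ?expR_ge0 // le_min ge_min lexx /= ge_min.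
    by rewrite ler_nat nm orbT.
  by case: ifPn => // _; rewrite lee_fin.
have gTm n : measurable_fun (`[0%R, +oo[ : set R) (gT n).
  apply: measurable_funTS.
  apply/(measurable_restrictT (fun t => (g n t)%:E)) => //.
  by apply/measurable_EFinP; exact: measurable_funTS (g_measurable n).
have limgT t : 0 <= t -> limn (gT^~ t) = (expR (- lam * t) * c t)%:E.
  move=> t0; apply/cvg_lim => //; apply: cvg_near_cst.
  exists (Num.truncn (Num.max t (c t))).+1 => // n /= nN.
  have : Num.max t (c t) < n%:R.
    rewrite (lt_le_trans (truncnS_gt _)) // ?ler_nat //.
  rewrite gt_max => /andP[tn cn].
  rewrite /gT patchE mem_set /=; last by rewrite in_itv /= t0 ltW.
  by rewrite /g min_l // ltW.
have -> : (\int[mu]_(t in `[0%R, +oo[) (expR (- lam * t) * c t)%:E =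
    \int[mu]_(t in `[0%R, +oo[) limn (gT^~ t))%E.
  by apply: eq_integral => t; rewrite inE /= in_itv /= andbT => t0; rewrite limgT.
rewrite monotone_convergence //; last first.
- by move=> n t _; rewrite /gT patchE; case: ifP => // _; rewrite lee_fin.
apply: lime_le; last first.
  apply: nearW => n.
  rewrite /gT -integral_mkcondr.
  have -> : `[0%R, +oo[ `&` `[0%R, n%:R] = `[0%R, n%:R] :> set R.
    apply/setIidPr => s /=; rewrite !in_itv /= => /andP[-> _] //.
  have /fineK <- : (\int[mu]_(t in `[0%R, n%:R]) (g n t)%:E)%E \is a fin_num.
    by apply: integrable_fin_num => //; exact: g_integrable.
  by rewrite lee_fin; apply: (G_bound n (ler0n _ n)).
apply: ereal_nondecreasing_is_cvgn => n m nm.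
apply: ge0_le_integral => //.
- by move=> t _; rewrite /gT patchE; case: ifP => // _; rewrite lee_fin.
- exact: gTm.
- exact: gTm.
- by move=> t _; exact: gTnd.
Qed.

End a_priori_estimate.

(** * Concavity inequalities and measurability for [u] *)

Section utility_function_theory.
Context (R : realType) (u : R -> R).
Hypothesis hu : utility_function u.

Lemma utility_le (x y : R) : 0 <= x -> x <= y -> u x <= u y.
Proof.
by move=> x0; rewrite le_eqVlt => /orP[/eqP -> //|/(utility_increasing hu x0)/ltW].
Qed.

Lemma utility_ge0 (x : R) : 0 <= x -> 0 <= u x.
Proof. by move=> x0; rewrite -(utility0 hu) utility_le. Qed.

Lemma utility_concave (x y t : R) : 0 <= x -> 0 <= y -> 0 <= t <= 1 ->
  t * u x + (1 - t) * u y <= u (t * x + (1 - t) * y).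
Proof.
move=> x0 y0 /andP[t0 t1].
have [<-|xy] := eqVneq x y; first by rewrite -!mulrDl addrC subrK !mul1r.
have [<-|tn0] := eqVneq 0 t; first by rewrite !mul0r !add0r subr0 !mul1r.
have [->|tn1] := eqVneq t 1; first by rewrite subrr !mul0r !addr0 !mul1r.
apply/ltW/(utility_strictly_concave hu) => //=; rewrite ?in_itv /= ?andbT //.
by rewrite !lt_neqAle tn0 t0 tn1 t1.
Qed.

(** Both [x + h] and [y] are convex combinations of [x] and [y + h], with exchanged weights; the two
    concavity inequalities add up to the claim. *)
Lemma utility_increment (x y h : R) : 0 <= x -> x <= y -> 0 <= h ->
  u (y + h) - u y <= u (x + h) - u x.
Proof.
move=> x0 xy h0; have [->|hn0] := eqVneq h 0; first by rewrite !addr0 !subrr.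
have d0 : 0 < y + h - x.
  have : 0 < h by rewrite lt_neqAle eq_sym hn0.
  lra.
pose t := (y - x) / (y + h - x).
have t01 : 0 <= t <= 1.
  by apply/andP; split; [apply: divr_ge0; lra | rewrite ler_pdivrMr // mul1r; lra].
have t01' : 0 <= 1 - t <= 1 by lra.
have := utility_concave x0 (_ : 0 <= y + h) t01.
have := utility_concave x0 (_ : 0 <= y + h) t01'.
have -> : t * x + (1 - t) * (y + h) = x + h by rewrite /t; field; rewrite gt_eqF.
have -> : (1 - t) * x + (1 - (1 - t)) * (y + h) = y by rewrite /t; field; rewrite gt_eqF.
have yh : 0 <= y + h by lra.
by move=> /(_ yh) h1 /(_ yh) h2; lra.
Qed.

(** Makes the gain linear in [h], with a slope that does not depend on [h]. *)
Lemma utility_slope (x h : R) : 0 <= x -> 0 <= h <= 1 ->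
  h * (u (x + 1) - u x) <= u (x + h) - u x.
Proof.
move=> x0 h01; have x1 : 0 <= x + 1 by lra.
have := utility_concave x1 x0 h01.
have -> : h * (x + 1) + (1 - h) * x = x + h by ring.
lra.
Qed.

(** Below [p] this is monotonicity. Above [p], concavity and [u 0 = 0] make [u c / c] at most
    [u p / p]. *)
Lemma utility_star (p c : R) : 0 < p -> 0 <= c -> u c <= u p * (1 + c / p).
Proof.
move=> p0 c0; have up := utility_ge0 (ltW p0).
have cp : 0 <= c / p by rewrite divr_ge0 // ltW.
have [cltp|pltc] := leP c p.
  apply: (le_trans (utility_le c0 cltp)).
  by rewrite mulrDr mulr1 lerDl mulr_ge0.
have c0' : 0 < c by exact: lt_trans pltc.
have pc01 : 0 <= p / c <= 1.
  by rewrite divr_ge0 ?(ltW p0) //= ler_pdivrMr // mul1r ltW.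
have := utility_concave c0 (lexx 0) pc01.
rewrite (utility0 hu) !mulr0 !addr0 divfK ?gt_eqF // => h.
have -> : u c = p / c * u c * (c / p) by field; rewrite !gt_eqF.
apply: (le_trans (ler_wpM2r cp h)).
by rewrite mulrDr mulr1 lerDr.
Qed.

(** Clamping the argument at 0 turns [u] into a function nondecreasing on the whole line, hence
    measurable, without changing it on the values of [c]. *)
Lemma measurable_utility (D : set R) (c : R -> R) : (forall t, 0 <= c t) ->
  measurable_fun D c -> measurable_fun D (fun t => u (c t)).
Proof.
move=> c0 mc; have -> : (fun t => u (c t)) = (fun x : R => u (Num.max x 0)) \o c.
  by apply/funext => t /=; rewrite max_l.
apply: measurableT_comp mc; apply: nondecreasing_measurable => // x y xy.
by apply: utility_le; [rewrite le_max lexx orbT | rewrite ge_max !le_max xy lexx orbT].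
Qed.

Lemma discounted_utility_ge0 rho (c t : R) : 0 <= c ->
  (0 <= (expR (- rho * t) * u c)%:E)%E.
Proof. by move=> c0; rewrite lee_fin mulr_ge0 ?expR_ge0 ?utility_ge0. Qed.

Lemma measurable_discounted_utility rho (D : set R) (c : R -> R) :
  (forall t, 0 <= c t) -> measurable_fun D c ->
  measurable_fun D (fun t => (expR (- rho * t) * u (c t))%:E).
Proof.
move=> c0 mc; apply/measurable_EFinP; apply: measurable_funM.
  exact: measurable_funTS (measurable_expR_linear _).
exact: measurable_utility.
Qed.

End utility_function_theory.

Lemma integral_expR_decay (R : realType) (l : R) : 0 < l ->
  (\int[lebesgue_measure]_(t in `[0%R, +oo[) (expR (- l * t))%:E = (l^-1)%:E)%E.
Proof.
move=> l0; have := integral_exponential_pdf l0.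
have -> : (\int[lebesgue_measure]_x (exponential_pdf l x)%:E =
  \int[lebesgue_measure]_(x in `[0%R, +oo[) (l%:E * (expR (- l * x))%:E))%E.
  rewrite [RHS]integral_mkcond; apply: eq_integral => x _.
  by rewrite /exponential_pdf !patchE; case: ifP.
rewrite ge0_integralZl //; last 2 first.
- by apply/measurable_EFinP; exact: measurable_funTS (measurable_expR_linear _).
- by rewrite lee_fin ltW.
move=> h; have : (l^-1%:E * (l%:E *
    \int[lebesgue_measure]_(t in `[0%R, +oo[) (expR (- l * t))%:E))%E =
    (l^-1%:E * 1)%E by rewrite h.
by rewrite muleA -EFinM mulVf ?gt_eqF // mul1e mule1.
Qed.

Lemma discounted_growth_bound (R : realType) (u : R -> R) (rho eps lam : R) :
  utility_function u -> 0 < rho -> 0 < eps -> 0 < lam ->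
  expR (eps * t) * expR (- rho * t) * u (expR (lam * t)) @[t --> +oo] --> 0 ->
  exists2 K, 0 <= K & forall t, 0 <= t ->
    expR (- rho * t) * u (expR (lam * t)) <= K * expR (- eps * t).
Proof.
move=> hu rho0 eps0 lam0 hgrowth.
have : \forall t \near +oo, expR (eps * t) * expR (- rho * t) * u (expR (lam * t)) < 1.
  by apply: (cvgr_lt 0 hgrowth); exact: ltr01.
move=> [t0 [_ ht0]]; pose t1 := Num.max t0 0.
(* The 1 serves for [t > t1], where the product in the limit is below 1. The other term serves up to
   [t1], where [u] is bounded by its value at [expR (lam * t1)] and [expR (- rho * t) <= expR (eps *
   (t1 - t))]. *)
pose K := Num.max 1 (u (expR (lam * t1)) * expR (eps * t1)).
exists K; first by rewrite le_max ler01.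
move=> t tge0; have [tt1|t1t] := leP t t1.
  apply: (@le_trans _ _ (u (expR (lam * t1)) * expR (eps * t1) * expR (- eps * t))); last first.
    by rewrite ler_wpM2r ?expR_ge0 // le_max lexx orbT.
  rewrite -mulrA -expRD mulrC; apply: ler_pM.
  - by rewrite (utility_ge0 hu) // expR_ge0.
  - exact: expR_ge0.
  - by rewrite (utility_le hu) ?expR_ge0 // ler_expR ler_wpM2l // ltW.
  rewrite ler_expR -lerBlDr.
  have : 0 <= eps * (t1 - t) by rewrite mulr_ge0 ?subr_ge0 // ltW.
  have : 0 <= rho * t by rewrite mulr_ge0 // ltW.
  lra.
have := ht0 t; rewrite /t1 in t1t; move: t1t; rewrite gt_max => /andP[-> _] /(_ isT) h.
have -> : expR (- rho * t) * u (expR (lam * t)) =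
    expR (eps * t) * expR (- rho * t) * u (expR (lam * t)) * expR (- eps * t).
  by rewrite [RHS]mulrC !mulrA -expRD [- eps * t]mulNr addNr expR0 mul1r.
rewrite ler_wpM2r ?expR_ge0 // (le_trans (ltW h)) //.
by rewrite le_max lexx.
Qed.

(** Consuming all production keeps the capital constant. This makes the set of admissible controls
    nonempty, so the value is nonnegative rather than [-oo]. *)
Lemma steady_trajectory (R : realType) (F : R -> R) (L k0 : R) :
  production_function F L -> 0 <= k0 ->
  trajectory F k0 (fun t => if 0 <= t then F k0 else 0) (cst k0).
Proof.
move=> hF k00; have Fk0 := production_ge0 hF k00.
have mc : measurable_fun setT (fun t : R => if 0 <= t then F k0 else 0).
  apply: measurable_fun_ifT => //.
  exact: measurable_fun_ler.
split => //.
- by move=> t; case: ifP.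
- by move=> t; rewrite leNgt => ->.
- move=> T T0; apply: measurable_bounded_integrable => //.
  + by rewrite /= lebesgue_measure_itv /=; case: ifP => _; rewrite ?ltry // -EFinB ltry.
  + exact: measurable_funTS.
  exists (F k0); split; first exact: num_real.
  move=> x xF t _ /=; apply: le_trans (ltW xF).
  by case: ifP => _; rewrite ?normr0 // ger0_norm.
- exact: cst_continuous.
- move=> T T0; apply: (@lipschitz_absolutely_continuous _ _ _ _ 0) => x y _ _ _.
  by rewrite subrr normr0 mul0r.
- by apply: aeW => t t0; rewrite ltW // subrr; exact: is_derive_cst.
Qed.

(** * Finiteness of the value *)

Section finite_value.
Context (R : realType) (F u : R -> R) (L rho eps : R).
Hypotheses (hF : production_function F L) (hu : utility_function u).
Hypotheses (rho0 : 0 < rho) (eps0 : 0 < eps).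
Hypothesis hgrowth : expR (eps * t) * expR (- rho * t) * u (expR ((L + eps) * t))
  @[t --> +oo] --> 0.
Local Notation mu := (@lebesgue_measure R).

Lemma trajectory_utility_ge0 k0 c k : trajectory F k0 c k ->
  (0 <= intertemporal_utility u rho c)%E.
Proof.
by move=> tr; apply: integral_ge0 => t _; apply: discounted_utility_ge0 => //;
  exact: trajectory_control_ge0 tr t.
Qed.

Lemma evalue_lty k0 : 0 <= k0 -> (evalue F u rho k0 < +oo)%E.
Proof.
move=> k00; pose lam := L + eps.
have lam0 : 0 < lam by rewrite addr_gt0 // (production_slope_gt0 hF).
have [M M0 FM] := production_affine_bound hF eps0.
have [K K0 hK] := discounted_growth_bound hu rho0 eps0 lam0 hgrowth.
(* [utility_star] at [expR (lam * t)] and the growth bound dominate the integrand by [K expR (- eps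
   * t) + K expR (- lam * t) c t], whose two parts integrate to at most these two terms. *)
apply: (@le_lt_trans _ _ (K / eps + K * (k0 + M / lam))%:E); last exact: ltry.
apply: evalue_le => c k tr; have c0 := trajectory_control_ge0 tr.
have mc : measurable_fun (`[0, +oo[ : set R) c by exact: measurable_funTS (trajectory_measurable tr).
have mE l : measurable_fun (`[0, +oo[ : set R) (fun t : R => expR (l * t)).
  exact: measurable_funTS (measurable_expR_linear l).
have mEc : measurable_fun (`[0, +oo[ : set R) (fun t : R => expR (- lam * t) * c t).
  exact: measurable_funM.
apply: (@le_trans _ _ (\int[mu]_(t in `[0%R, +oo[)
    (K%:E * (expR (- eps * t))%:E + K%:E * (expR (- lam * t) * c t)%:E))%E).
  apply: ge0_le_integral => //.
  - by move=> t _; apply: discounted_utility_ge0.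
  - exact: measurable_discounted_utility.
  - rewrite -[X in measurable_fun _ X]/(EFin \o
      (fun t => K * expR (- eps * t) + K * (expR (- lam * t) * c t))).
    apply/measurable_EFinP; apply: measurable_funD; apply: measurable_funM => //.
    exact: mE.
  move=> t; rewrite /= in_itv /= andbT => t0.
  rewrite -!EFinM -EFinD lee_fin.
  have p0 := expR_gt0 (lam * t).
  apply: (@le_trans _ _ (expR (- rho * t) * (u (expR (lam * t)) * (1 + c t / expR (lam * t))))).
    by rewrite ler_wpM2l ?expR_ge0 // (utility_star hu).
  have cp : 0 <= c t / expR (lam * t) by rewrite divr_ge0 // ltW.
  rewrite mulrA; apply: (le_trans (ler_wpM2r (_ : 0 <= 1 + _) (hK t t0))).
    by rewrite addr_ge0.
  have -> : c t / expR (lam * t) = expR (- lam * t) * c t by rewrite mulNr expRN mulrC.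
  rewrite mulrDr mulr1 lerD2l -mulrA ler_wpM2l // ler_piMl //.
    by rewrite mulr_ge0 ?expR_ge0.
  by rewrite expR_decay_le1 // ltW.
have Ec0 t : (0 <= (expR (- lam * t) * c t)%:E)%E by rewrite lee_fin mulr_ge0 ?expR_ge0.
have mEe : measurable_fun (`[0, +oo[ : set R) (fun t : R => (expR (- eps * t))%:E).
  by apply/measurable_EFinP; exact: mE.
have mEce : measurable_fun (`[0, +oo[ : set R) (fun t : R => (expR (- lam * t) * c t)%:E).
  exact/measurable_EFinP.
rewrite ge0_integralD //; last 4 first.
- by move=> t _; apply: mule_ge0; rewrite lee_fin // expR_ge0.
- exact: measurable_funeM.
- by move=> t _; apply: mule_ge0; rewrite // lee_fin.
- exact: measurable_funeM.
rewrite !ge0_integralZl //.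
rewrite integral_expR_decay // EFinD !EFinM leeD2l // lee_wpmul2l ?lee_fin //.
exact: trajectory_discounted_consumption tr.
Qed.

Lemma evalue_fin_num k0 : 0 <= k0 -> evalue F u rho k0 \is a fin_num.
Proof.
move=> k00; rewrite ge0_fin_numE; first exact: evalue_lty.
have tr := steady_trajectory hF k00.
exact: le_trans (trajectory_utility_ge0 tr) (evalue_ge u rho tr).
Qed.

Lemma valueE k0 : 0 <= k0 -> evalue F u rho k0 = (value F u rho k0)%:E.
Proof. by move=> k00; rewrite fineK // evalue_fin_num. Qed.

Lemma value_ge0 k0 : 0 <= k0 -> 0 <= value F u rho k0.
Proof.
move=> k00; rewrite -lee_fin -valueE //.
have tr := steady_trajectory hF k00.
exact: le_trans (trajectory_utility_ge0 tr) (evalue_ge u rho tr).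
Qed.

End finite_value.

(** * Perturbed trajectories: early and delayed consumption *)

Section continuous_real_functions.
Context (R : realType).
Implicit Types f g : R -> R.

Lemma continuous_maxr f g : continuous f -> continuous g ->
  continuous (fun t => Num.max (f t) (g t)).
Proof. by move=> cf cg t; exact: (@continuous_max R R f g t (cf t) (cg t)). Qed.

Lemma continuous_minr f g : continuous f -> continuous g ->
  continuous (fun t => Num.min (f t) (g t)).
Proof. by move=> cf cg t; exact: (@continuous_min R R f g t (cf t) (cg t)). Qed.

Lemma continuous_compose f g : continuous f -> continuous g ->
  continuous (fun t => g (f t)).
Proof. by move=> cf cg t; exact: (@continuous_comp _ _ _ f g t (cf t) (cg (f t))). Qed.

End continuous_real_functions.

Lemma continuous_integrable_itv (R : realType) (f : R -> R) (a b : R) :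
  continuous f -> lebesgue_measure.-integrable `[a, b] (EFin \o f).
Proof.
move=> cf; apply: continuous_compact_integrable; first exact: segment_compact.
exact: continuous_subspaceT.
Qed.

(* The state is lifted by [h (1 - t)^+], so the extra capital [h] is entirely
   consumed by time [1]. *)
Section early_consumption.
Context (R : realType) (F : R -> R) (L h k0 : R) (c k : R -> R).
Hypotheses (hF : production_function F L) (h0 : 0 <= h) (tr : trajectory F k0 c k).
Local Notation mu := (@lebesgue_measure R).

Let ramp (t : R) := h * Num.max (1 - t) 0.
Let surplus (t : R) := F (k t + ramp t) - F (k t).

(** Production minus growth of the lifted state: the lift adds [surplus] to production, and the
    descent of the ramp frees the rate [h] on [0, 1]. *)
Definition early_control (t : R) : R :=
  c t + ((surplus \_ `[0, +oo[) t + h * \1_`[0, 1] t).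

Let ramp_ge0 t : 0 <= ramp t.
Proof. by rewrite mulr_ge0 // le_max lexx orbT. Qed.

Let surplus_ge0 t : 0 <= surplus t.
Proof. by rewrite subr_ge0 (production_le hF) // lerDl. Qed.

Let ramp_continuous : continuous ramp.
Proof.
move=> t; apply: cvgM; first exact: cvg_cst.
apply: (@continuous_maxr _ (fun t => 1 - t) (cst 0)); last exact: cst_continuous.
by move=> z; apply: cvgB; [exact: cvg_cst | exact: cvg_id].
Qed.

Let surplus_continuous : continuous surplus.
Proof.
move=> t; apply: cvgB; last first.
  exact: (continuous_compose (trajectory_continuous tr) (production_continuous hF)).
apply: (@continuous_compose _ (k \+ ramp) F _ (production_continuous hF)) => z.
by apply: cvgD; [exact: trajectory_continuous tr z | exact: ramp_continuous].
Qed.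

Lemma early_control_ge t : 0 <= t <= 1 -> c t + h <= early_control t.
Proof.
move=> t01; rewrite /early_control lerD2l indicE mem_set //= ?in_itv //= mulr1 lerDr.
by rewrite patchE; case: ifP.
Qed.

Lemma early_control_ge_control t : c t <= early_control t.
Proof.
rewrite /early_control lerDl addr_ge0 ?mulr_ge0 //.
by rewrite patchE; case: ifP.
Qed.

Lemma early_trajectory : trajectory F (k0 + h) early_control (k \+ ramp).
Proof.
have ms : measurable_fun setT (surplus \_ `[0, +oo[).
  apply/(measurable_restrictT surplus) => //; apply: measurable_funTS.
  exact: continuous_measurable_fun surplus_continuous.
have mi : measurable_fun setT (fun t : R => h * \1_`[0, 1] t).
  by apply: measurable_funM => //; exact: measurable_indic.
split.
- apply: measurable_funD; first exact: trajectory_measurable tr.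
  exact: measurable_funD.
- move=> t; apply: le_trans (early_control_ge_control t).
  exact: trajectory_control_ge0 tr t.
- move=> t t0; rewrite /early_control (trajectory_control_neg tr) // patchE indicE.
  by rewrite !memNset ?mulr0 ?addr0 //= in_itv /= leNgt t0.
- move=> T T0.
  have -> : EFin \o early_control = (EFin \o c) \+
    ((EFin \o (surplus \_ `[0, +oo[)) \+ (EFin \o (fun t : R => h * \1_`[0, 1] t))).
    by apply/funext => t; rewrite /= -!EFinD.
  apply: integrableD => //; first exact: trajectory_L1loc tr T T0.
  apply: integrableD => //.
    apply: eq_integrable (continuous_integrable_itv 0 T surplus_continuous) => //.
    move=> t; rewrite inE /= in_itv /= => /andP[t0 _].
    by rewrite patchE mem_set //= in_itv /= t0.
  apply: measurable_bounded_integrable => //.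
  + by rewrite /= lebesgue_measure_itv /=; case: ifP => _; rewrite ?ltry // -EFinB ltry.
  + exact: measurable_funTS.
  exists h; split; first exact: num_real.
  move=> x hx t _ /=; apply: le_trans (ltW hx).
  rewrite ger0_norm ?mulr_ge0 // indicE ler_piMr //.
  by case: (_ \in _).
- move=> t; apply: cvgD; [exact: trajectory_continuous tr t | exact: ramp_continuous].
- by rewrite /= (trajectory_initial tr) /ramp subr0 max_l // mulr1.
- by move=> t; rewrite addr_ge0 // (trajectory_state_ge0 tr).
- move=> T T0; apply: absolutely_continuousD; first exact: trajectory_ac tr T T0.
  apply: (@lipschitz_absolutely_continuous _ _ _ _ h) => x y _ xy _.
  rewrite /ramp -mulrBr normrM ger0_norm // ler_wpM2l //.
  rewrite /Num.max ler_norml; do 2 case: ifPn; rewrite -?leNgt => ? ?; lra.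
(* The ramp may have a corner at time 1. *)
- move: (ae_neq (1 : R)) (trajectory_ode tr).
  apply: filterS2 => [|t t1 kt t0]; first exact: (ae_filter_ringOfSetsType mu).
  have {}kt := kt t0.
  rewrite /early_control patchE mem_set /=; last by rewrite in_itv /= ltW.
  rewrite indicE.
  have dramp (d : R) : is_derive t 1 ramp d ->
      is_derive t 1 (k \+ ramp) (F (k t) - c t + d).
    by move=> dr; apply: is_deriveD.
  have [tlt|tgt|/eqP] := ltgtP t 1; last by rewrite (negbTE t1).
  + rewrite mem_set /=; last by rewrite in_itv /= !ltW.
    apply: is_derive_eq (dramp (- h) _) _; last by rewrite /surplus /=; ring.
    have : is_derive t 1 (fun s : R => h *: (1 - s)) (- h).
      by apply: is_derive_eq; rewrite /GRing.scale /=; ring.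
    apply: near_eq_is_derive; near=> s; rewrite /ramp max_l //.
    by rewrite subr_ge0 ltW //; near: s; exact: lt_nbhsl.
  + rewrite memNset /=; last by rewrite in_itv /= [t <= 1]leNgt tgt andbF.
    apply: is_derive_eq (dramp 0 _) _.
      apply: near_eq_is_derive (is_derive_cst 0 t 1); near=> s.
      rewrite /ramp max_r ?mulr0 // subr_le0 ltW //; near: s; exact: lt_nbhsr.
    rewrite /surplus /= /ramp max_r ?mulr0 ?addr0 ?subrr ?subr_le0 ?ltW //; ring.
Unshelve. all: by end_near. Qed.

End early_consumption.

(* While waiting, the state grows linearly with slope [F k0 <= F (k t)]; it has
   reached [k0 + h] after [h / F k0] units of time, and the given trajectory is
   followed with this delay. *)
Section delayed_consumption.
Context (R : realType) (F : R -> R) (L h k0 : R) (c k : R -> R).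
Hypotheses (hF : production_function F L) (k00 : 0 < k0) (h0 : 0 <= h).
Hypothesis tr : trajectory F (k0 + h) c k.
Local Notation mu := (@lebesgue_measure R).

Let s := F k0.
Let tau := h / s.
Let wait (t : R) := F (k0 + s * t) - s.

(** During the wait the state is at least [k0], so growing at the rate [F k0] leaves a nonnegative
    consumption [wait]. *)
Definition delayed_control (t : R) : R := (wait \_ `[0, tau[) t + c (t - tau).

(** Before [tau] the first term is frozen at [k0 + h] and the second climbs from [- h] to 0;
    afterwards only the delayed [k] remains. With clamps instead of cases, continuity and absolute
    continuity follow term by term. *)
Definition delayed_state (t : R) : R :=
  k (Num.max (t - tau) 0) + (s * Num.min (Num.max t 0) tau - h).

Let s0 : 0 < s. Proof. by rewrite /s (production_gt0 hF). Qed.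
Let tau0 : 0 <= tau. Proof. by rewrite divr_ge0 // ltW. Qed.
Let stau : s * tau = h. Proof. by rewrite /tau; field; rewrite gt_eqF. Qed.

Let wait_continuous : continuous wait.
Proof.
move=> t; apply: cvgB; last exact: cvg_cst.
apply: (@continuous_compose _ (fun t => k0 + s * t) F _ (production_continuous hF)) => z.
by apply: cvgD; [exact: cvg_cst | apply: cvgM; [exact: cvg_cst | exact: cvg_id]].
Qed.

Let wait_ge0 t : 0 <= t -> 0 <= wait t.
Proof. by move=> t0; rewrite subr_ge0 (production_le hF) // lerDl mulr_ge0 // ltW. Qed.

Let delay_measurable : measurable_fun setT (fun t : R => c (t - tau)).
Proof.
exact: (measurableT_comp (trajectory_measurable tr) (measurable_shift tau)).
Qed.

Let delay_integrable (T : R) : 0 <= T ->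
  mu.-integrable `[0, T] (EFin \o (fun t => c (t - tau))).
Proof.
move=> T0; apply/integrableP; split.
  by apply/measurable_EFinP; exact: measurable_funTS.
(* For times in [0, T] the shifted control reads [c] only at times up to [T], and [c] vanishes at
   negative times; cutting [c] to [0, T] thus allows translation on the whole line. *)
pose C : R -> \bar R := (EFin \o c) \_ `[0, T].
have C0 t : (0 <= C t)%E.
  by rewrite /C patchE; case: ifP => // _; rewrite lee_fin (trajectory_control_ge0 tr).
have mC : measurable_fun setT C.
  apply/(measurable_restrictT (EFin \o c)) => //.
  by apply/measurable_EFinP; exact: measurable_funTS (trajectory_measurable tr).
have mCs : measurable_fun setT (fun t : R => C (t - tau)%R).
  exact: (measurableT_comp mC (measurable_shift tau)).
apply: (@le_lt_trans _ _ (\int[mu]_t C (t - tau)%R)%E).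
  apply: (@le_trans _ _ (\int[mu]_(t in `[0%R, T]) C (t - tau)%R)%E); last first.
    by apply: ge0_subset_integral => //.
  apply: ge0_le_integral => //.
  - apply/measurable_EFinP; apply: measurableT_comp => //.
    exact: measurable_funTS.
  - exact: measurable_funTS.
  move=> t /=; rewrite in_itv /= => /andP[t0 tT].
  rewrite ger0_norm ?(trajectory_control_ge0 tr) // /C patchE.
  case: ifPn => // /negP tn; rewrite (trajectory_control_neg tr) // ltNge.
  apply/negP => tt; apply: tn; rewrite inE /= in_itv /= tt lerBlDr.
  by rewrite (le_trans tT) // lerDl.
have := @ge0_integral_shift R tau setT C measurableT mC (fun t _ => C0 t).
rewrite preimage_setT => ->.
have /integrableP[_] := trajectory_L1loc tr T0.
rewrite /C -integral_mkcond; apply: le_lt_trans.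
apply: ge0_le_integral => //.
- by move=> t _; rewrite /= lee_fin (trajectory_control_ge0 tr).
- by apply/measurable_EFinP; exact: measurable_funTS (trajectory_measurable tr).
- apply/measurable_EFinP; apply: measurableT_comp => //.
  exact: measurable_funTS (trajectory_measurable tr).
- by move=> t _ /=; rewrite lee_fin ler_norm.
Qed.

Lemma delayed_trajectory : trajectory F k0 delayed_control delayed_state.
Proof.
have mw : measurable_fun setT (wait \_ `[0, tau[).
  apply/(measurable_restrictT wait) => //; apply: measurable_funTS.
  exact: continuous_measurable_fun wait_continuous.
split.
- exact: measurable_funD.
- move=> t; rewrite addr_ge0 ?(trajectory_control_ge0 tr) // patchE.
  by case: ifPn => //; rewrite inE /= in_itv /= => /andP[/wait_ge0].
- move=> t t0; rewrite /delayed_control (trajectory_control_neg tr).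
    by rewrite patchE memNset ?addr0 //= in_itv /= leNgt t0.
  by rewrite subr_lt0 (lt_le_trans t0 tau0).
- move=> T T0.
  have -> : EFin \o delayed_control = (EFin \o (wait \_ `[0, tau[)) \+
      (EFin \o (fun t => c (t - tau))).
    by apply/funext => t; rewrite /= -!EFinD.
  apply: integrableD => //; last exact: delay_integrable.
  apply: le_integrable (continuous_integrable_itv 0 T wait_continuous) => //.
    by apply/measurable_EFinP; exact: measurable_funTS.
  move=> t _ /=; rewrite lee_fin patchE; case: ifP => // _.
  by rewrite normr0.
- move=> t; apply: cvgD.
    apply: (@continuous_compose _ (fun t => Num.max (t - tau) 0) k _ (trajectory_continuous tr)).
    apply: (@continuous_maxr _ (fun t => t - tau) (cst 0)); last exact: cst_continuous.
    by move=> z; apply: cvgB; [exact: cvg_id | exact: cvg_cst].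
  apply: cvgB; last exact: cvg_cst.
  apply: cvgM; first exact: cvg_cst.
  apply: (@continuous_minr _ (fun t => Num.max t 0) (cst tau)); last exact: cst_continuous.
  by apply: (@continuous_maxr _ id (cst 0)) => z; [exact: cvg_id | exact: cst_continuous].
- rewrite /delayed_state maxxx min_l // mulr0 max_r; last by rewrite sub0r oppr_le0.
  by rewrite (trajectory_initial tr); ring.
- move=> t; rewrite /delayed_state; have [tt|tt] := leP tau t.
    rewrite [Num.min _ _]min_r; last by rewrite le_max tt.
    by rewrite stau subrr addr0 (trajectory_state_ge0 tr).
  rewrite [Num.max (t - tau) 0]max_r ?(trajectory_initial tr); last by rewrite subr_le0 ltW.
  have : 0 <= s * Num.min (Num.max t 0) tau.
    by rewrite mulr_ge0 ?(ltW s0) // le_min tau0 le_max lexx orbT.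
  by move: k00; lra.
- move=> T T0; apply: absolutely_continuousD.
    exact: absolutely_continuous_delay (trajectory_ac tr T0).
  apply: (@lipschitz_absolutely_continuous _ _ _ _ s) => x y _ xy _.
  rewrite opprB addrA subrK -mulrBr normrM (ger0_norm (ltW s0)).
  rewrite ler_wpM2l ?(ltW s0) // ler_norml /Num.max /Num.min.
  by do 4 case: ifPn; rewrite -?leNgt => ? ? ? ?; lra.
- move: (ae_neq tau) (ae_shift tau (trajectory_ode tr)).
  apply: filterS2 => [|t ttau kt t0]; first exact: (ae_filter_ringOfSetsType mu).
  rewrite /delayed_control patchE.
  have [tlt|tgt|/eqP] := ltgtP t tau; last by rewrite (negbTE ttau).
  + rewrite mem_set /=; last by rewrite in_itv /= ltW.
    rewrite (trajectory_control_neg tr) ?subr_lt0 // addr0.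
    have : is_derive t 1 (fun r : R => s *: r + k0) s.
      by apply: is_derive_eq; rewrite /GRing.scale /=; ring.
    have statet (r : R) : 0 <= r -> r <= tau -> delayed_state r = s * r + k0.
      move=> r0 rt; rewrite /delayed_state max_r ?subr_le0 // (trajectory_initial tr).
      by rewrite max_l // min_l //; ring.
    move=> ds; apply: is_derive_eq (near_eq_is_derive _ ds) _.
      near=> r; rewrite statet //; apply/ltW; near: r; first exact: lt_nbhsr.
      exact: lt_nbhsl.
    by rewrite statet ?ltW // /wait [k0 + _]addrC; ring.
  + rewrite memNset /=; last by rewrite in_itv /= [t < _]ltNge (ltW tgt) andbF.
    rewrite add0r.
    have statet (r : R) : tau <= r -> delayed_state r = k (r - tau).
      move=> rt; rewrite /delayed_state max_l ?subr_ge0 // min_r ?le_max ?rt //.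
      by rewrite stau subrr addr0.
    rewrite statet ?ltW //.
    have := kt; rewrite subr_gt0 => /(_ tgt) dk.
    have ds : is_derive t 1 (fun r : R => r - tau) 1.
      by apply: is_derive_eq; rewrite subr0.
    have := @is_derive1_comp R k (fun r => r - tau) t _ _ dk ds; rewrite mulr1.
    apply: near_eq_is_derive; near=> r; rewrite /= statet //.
    by apply/ltW; near: r; exact: lt_nbhsr.
Unshelve. all: by end_near. Qed.

(** Translating time by [tau] multiplies the discount by [expR (- rho * tau)]; the utility collected
    while waiting is nonnegative and is dropped. *)
Lemma delayed_utility (u : R -> R) (rho : R) : utility_function u ->
  ((expR (- rho * tau))%:E * intertemporal_utility u rho c <=
   intertemporal_utility u rho delayed_control)%E.
Proof.
move=> hu; have dt := delayed_trajectory.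
have cge0 := trajectory_control_ge0 tr; have dge0 := trajectory_control_ge0 dt.
have mc : measurable_fun (`[0, +oo[ : set R) c.
  exact: measurable_funTS (trajectory_measurable tr).
pose f (t : R) := (expR (- rho * t) * u (c t))%:E.
have mf : measurable_fun (`[0, +oo[ : set R) f by exact: measurable_discounted_utility.
have f0 t : (0 <= f t)%E by exact: discounted_utility_ge0.
have -> : ((expR (- rho * tau))%:E * intertemporal_utility u rho c =
    \int[mu]_(t in (fun t => (t - tau)%R) @^-1` `[0%R, +oo[)
      ((expR (- rho * tau))%:E * f (t - tau)%R))%E.
  rewrite (@ge0_integral_shift R tau _ (fun t => ((expR (- rho * tau))%:E * f t)%E)) //.
  - by rewrite ge0_integralZl // lee_fin expR_ge0.
  - exact: measurable_funeM.
  - by move=> t _; apply: mule_ge0 => //; rewrite lee_fin expR_ge0.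
have pre : (fun t => t - tau) @^-1` `[0, +oo[ = `[tau, +oo[ :> set R.
  by apply/seteqP; split => t /=; rewrite !in_itv /= !andbT subr_ge0.
rewrite pre; apply: (@le_trans _ _ (\int[mu]_(t in `[tau, +oo[)
    (expR (- rho * t) * u (delayed_control t))%:E)%E).
  rewrite le_eqVlt; apply/orP; left; apply/eqP; apply: eq_integral => t.
  rewrite inE /= in_itv /= andbT => taut.
  rewrite /f -EFinM mulrA -expRD /delayed_control patchE memNset /=; last first.
    by rewrite in_itv /= [t < _]ltNge taut andbF.
  by rewrite add0r; congr ((expR _ * _)%:E); ring.
apply: ge0_subset_integral => //.
- by apply: measurable_discounted_utility => //; exact: measurable_funTS (trajectory_measurable dt).
- by move=> t _; exact: discounted_utility_ge0.
- by move=> t /=; rewrite !in_itv /= !andbT; exact: le_trans.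
Qed.

End delayed_consumption.

(** * Gain from extra capital and cost of a delay, for the value *)

Section value_function.
Context (R : realType) (F u : R -> R) (L rho eps : R).
Hypotheses (hF : production_function F L) (hu : utility_function u).
Hypotheses (rho0 : 0 < rho) (eps0 : 0 < eps).
Hypothesis hgrowth : expR (eps * t) * expR (- rho * t) * u (expR ((L + eps) * t))
  @[t --> +oo] --> 0.
Local Notation mu := (@lebesgue_measure R).
Local Notation V := (value F u rho).

Let evalueE k0 : 0 <= k0 -> evalue F u rho k0 = (V k0)%:E.
Proof. exact: (valueE hF hu rho0 eps0 hgrowth). Qed.

(** Where [c <= A] on [0, 1], consuming [h] more brings at least [u (A + h) - u A]. Where [c > A],
    this amount is charged to [c / A > 1] instead, and the total charge is at most half of the
    gain. *)
Lemma value_gain (kmax : R) : exists2 A, 0 < A & forall k0 h, 0 <= k0 <= kmax -> 0 <= h ->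
  V k0 + expR (- rho) / 2 * (u (A + h) - u A) <= V (k0 + h).
Proof.
pose lam := L + eps.
have lam0 : 0 < lam by rewrite addr_gt0 // (production_slope_gt0 hF).
have [M M0 FM] := production_affine_bound hF eps0.
(* Bounds the consumption over [0, 1] for all initial capitals up to [kmax]; [expR lam] undoes the
   discount there. *)
pose m := expR lam * (Num.max kmax 0 + M / lam).
have m0 : 0 <= m.
  by rewrite mulr_ge0 ?expR_ge0 // addr_ge0 ?divr_ge0 ?(ltW lam0) // le_max lexx orbT.
(* Chosen so that [m / A <= 1 / 2]; the added 1 keeps [A] positive when [m = 0]. *)
pose A := 2 * m + 1.
have A0 : 0 < A by rewrite ltr_wpDl // mulr_ge0.
exists A => // k0 h /andP[k00 k0m] h0.
have kh0 : 0 <= k0 + h by rewrite addr_ge0.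
pose gA := u (A + h) - u A.
have gA0 : 0 <= gA by rewrite subr_ge0 (utility_le hu) ?(ltW A0) // lerDl.
pose D := expR (- rho) * gA.
have D0 : 0 <= D by rewrite mulr_ge0 ?expR_ge0.
rewrite -lerBrDr -lee_fin -(evalueE k00).
apply: evalue_le => c k tr; have c0 := trajectory_control_ge0 tr.
pose c' := early_control F h c k.
have tr' : trajectory F (k0 + h) c' _ := early_trajectory hF h0 tr.
have c'0 := trajectory_control_ge0 tr'.
have UV := evalue_ge u rho tr'; rewrite evalueE // in UV.
have mc : measurable_fun (`[0, +oo[ : set R) c.
  exact: measurable_funTS (trajectory_measurable tr).
have mc' : measurable_fun (`[0, +oo[ : set R) c'.
  exact: measurable_funTS (trajectory_measurable tr').
have mE : measurable_fun (`[0, +oo[ : set R) (fun t : R => (expR (- lam * t) * c t)%:E).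
  apply/measurable_EFinP; apply: measurable_funM => //.
  exact: measurable_funTS (measurable_expR_linear _).
have mI : measurable_fun (`[0, +oo[ : set R) (fun t : R => (\1_`[0, 1] t : R)%:E).
  by apply/measurable_EFinP; apply: measurable_funTS; exact: measurable_indic.
pose B := D / A * expR lam.
have B0 : 0 <= B by rewrite mulr_ge0 ?expR_ge0 // divr_ge0 // ltW.
have E0 t : (0 <= (expR (- lam * t) * c t)%:E)%E by rewrite lee_fin mulr_ge0 ?expR_ge0.
have I0 t : (0 <= (\1_`[0, 1] t : R)%:E)%E by rewrite lee_fin.
(* The charge stands on the right instead of being subtracted on the left, so that all integrands
   are nonnegative and the integrals split without integrability conditions. *)
have pointwise t : 0 <= t ->
    expR (- rho * t) * u (c t) + D * \1_`[0, 1] t <=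
    expR (- rho * t) * u (c' t) + B * (expR (- lam * t) * c t).
  move=> t0; rewrite indicE.
  have Bc0 : 0 <= B * (expR (- lam * t) * c t) by rewrite mulr_ge0 // mulr_ge0 ?expR_ge0.
  case: (boolP (t \in (`[0, 1] : set R))) => [|_] /=; last first.
    rewrite mulr0 addr0; apply: ler_wpDr => //; rewrite ler_wpM2l ?expR_ge0 //.
    apply: (utility_le hu) => //; exact: (early_control_ge_control c k hF h0).
  rewrite inE /= in_itv /= => t01; rewrite mulr1.
  pose g := u (c t + h) - u (c t).
  have g0 : 0 <= g by rewrite subr_ge0 (utility_le hu) // lerDl.
  have gAg : gA <= g + gA / A * c t.
    have [cA|Ac] := leP (c t) A.
      apply: ler_wpDr; first by rewrite mulr_ge0 // divr_ge0 // ltW.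
      exact: utility_increment.
    apply: ler_wpDl => //; rewrite -mulrA ler_peMr //.
    by rewrite mulrC ler_pdivlMr // mul1r ltW.
  have eg : expR (- rho) * g <= expR (- rho * t) * g.
    rewrite ler_wpM2r // ler_expR mulNr lerN2 ler_piMr ?(ltW rho0) //.
    by case/andP: t01.
  have cB : D / A * c t <= B * (expR (- lam * t) * c t).
    have -> : B * (expR (- lam * t) * c t) = D / A * (expR (lam * (1 - t)) * c t).
      have -> : lam * (1 - t) = lam + - lam * t by ring.
      by rewrite /B expRD; ring.
    rewrite ler_wpM2l ?divr_ge0 ?(ltW A0) // ler_peMl //.
    rewrite (le_trans _ (expR_ge1Dx _)) // lerDl mulr_ge0 ?(ltW lam0) // subr_ge0.
    by case/andP: t01.
  have uc' : u (c t + h) <= u (c' t).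
    by rewrite (utility_le hu) ?addr_ge0 // (early_control_ge c k hF h0).
  have : expR (- rho * t) * u (c t + h) <= expR (- rho * t) * u (c' t).
    by rewrite ler_wpM2l ?expR_ge0.
  have : D <= expR (- rho) * g + D / A * c t.
    by rewrite -!mulrA -mulrDr mulrA ler_wpM2l ?expR_ge0 // mulrA.
  rewrite /g mulrBr in eg *; lra.
have UD : (intertemporal_utility u rho c + D%:E <=
    intertemporal_utility u rho c' + (B * (k0 + M / lam))%:E)%E.
  have -> : (D%:E = \int[mu]_(t in `[0%R, +oo[) (D%:E * (\1_`[0, 1] t : R)%:E))%E.
    rewrite ge0_integralZl // integral_indic // setIidl.
      by rewrite /= lebesgue_measure_itv /= lte_fin ltr01 oppr0 adde0 mule1.
    by move=> z /=; rewrite !in_itv /= => /andP[->].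
  rewrite -ge0_integralD //; last 4 first.
  - by move=> t _; exact: discounted_utility_ge0.
  - exact: measurable_discounted_utility.
  - by move=> t _; apply: mule_ge0.
  - exact: measurable_funeM.
  apply: (@le_trans _ _ (\int[mu]_(t in `[0%R, +oo[)
      ((expR (- rho * t) * u (c' t))%:E + B%:E * (expR (- lam * t) * c t)%:E))%E).
    apply: ge0_le_integral => //.
    - by move=> t _; apply: adde_ge0; [exact: discounted_utility_ge0 | apply: mule_ge0].
    - apply: emeasurable_funD; first exact: measurable_discounted_utility.
      exact: measurable_funeM.
    - apply: emeasurable_funD; first exact: measurable_discounted_utility.
      exact: measurable_funeM.
    - move=> t /=; rewrite in_itv /= andbT => t0.
      by rewrite -!EFinM -!EFinD lee_fin pointwise.
  rewrite ge0_integralD //; last 4 first.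
  - by move=> t _; exact: discounted_utility_ge0.
  - exact: measurable_discounted_utility.
  - by move=> t _; apply: mule_ge0.
  - exact: measurable_funeM.
  rewrite ge0_integralZl //; apply: leeD2l; rewrite [leRHS]EFinM.
  apply: lee_wpmul2l; first by rewrite lee_fin.
  exact: (trajectory_discounted_consumption lam0 M0 FM tr).
have BD : B * (k0 + M / lam) <= D / 2.
  apply: (@le_trans _ _ (D / A * m)).
    rewrite /B /m -!mulrA !ler_wpM2l ?invr_ge0 ?expR_ge0 ?(ltW A0) //.
    by rewrite lerD2r le_max k0m.
  rewrite -mulrA ler_wpM2l // ler_pdivrMl // /A; lra.
have -> : V (k0 + h) - expR (- rho) / 2 * gA = V (k0 + h) + D / 2 - D.
  by rewrite /D; field.
rewrite EFinB leeBrDr // (le_trans UD) // EFinD leeD // lee_fin.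
Qed.

Lemma value_delay k0 h : 0 < k0 -> 0 <= h ->
  expR (- rho * (h / F k0)) * V (k0 + h) <= V k0.
Proof.
move=> k00 h0; have e0 := expR_gt0 (- rho * (h / F k0)).
have kh0 : 0 <= k0 + h by rewrite addr_ge0 // ltW.
rewrite -ler_pdivlMl // -lee_fin -(evalueE kh0).
apply: evalue_le => c k tr.
have tr' := delayed_trajectory hF k00 h0 tr.
have := le_trans (delayed_utility hF k00 h0 tr rho hu) (evalue_ge u rho tr').
rewrite evalueE ?(ltW k00) // => h1.
by rewrite EFinM lee_pdivlMl.
Qed.

End value_function.

Unset Implicit Arguments.

Theorem theorem25 (R : realType) (F u : R -> R) (L rho eps0 : R)
    (hF : production_function F L) (hu : utility_function u)
    (hrho : 0 < rho) (heps0 : 0 < eps0)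
    (hgrowth : expR (eps0 * t) * expR (- rho * t) * u (expR ((L + eps0) * t))
                 @[t --> +oo] --> 0) :
  [/\ (* V is real-valued on [0, +oo[ *)
      forall k0 : R, 0 <= k0 -> evalue F u rho k0 \is a fin_num,
      forall k1 k2 : R, 0 <= k1 -> k1 < k2 ->
        value F u rho k1 < value F u rho k2,
      forall k0 : R, 0 < k0 -> exists C delta : R,
        [/\ 0 < C, 0 < delta, delta <= k0 &
          forall h : R, - delta < h < delta -> h != 0 ->
            C <= (value F u rho (k0 + h) - value F u rho k0) / h] &
      forall a b : R, 0 < a -> a <= b ->
        [lipschitz (value F u rho) x | x in `[a, b]]].
Proof.
have gain := value_gain hF hu hrho heps0 hgrowth.
have e0 : 0 < expR (- rho) / 2 by rewrite divr_gt0 // expR_gt0.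
have incr k1 k2 : 0 <= k1 -> k1 < k2 -> value F u rho k1 < value F u rho k2.
  move=> k10 k12; have [A A0 hA] := gain k1.
  have kk : 0 <= k1 <= k1 by rewrite k10 lexx.
  have h0 : 0 < k2 - k1 by rewrite subr_gt0.
  have := hA k1 (k2 - k1) kk (ltW h0); rewrite [k1 + _]addrC subrK.
  apply: lt_le_trans; rewrite ltrDl mulr_gt0 // subr_gt0.
  by apply: (utility_increasing hu); [exact: ltW | rewrite ltrDl].
split => //.
- by move=> k0; exact: (evalue_fin_num hF hu hrho heps0 hgrowth).
- move=> k0 k00; have [A A0 hA] := gain k0.
  have dA : 0 < u (A + 1) - u A.
    by rewrite subr_gt0 (utility_increasing hu) ?ltrDl // ltW.
  pose C := expR (- rho) / 2 * (u (A + 1) - u A).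
  (* Needed at every base point up to [k0]: a negative [h] is treated as a gain of [- h] starting
     from [k0 + h]. *)
  have Ch (x h : R) : 0 <= x <= k0 -> 0 <= h <= 1 ->
      C * h <= value F u rho (x + h) - value F u rho x.
    move=> xk h01; rewrite lerBrDl.
    apply: le_trans (hA x h xk (proj1 (andP h01))); rewrite lerD2l /C -mulrA.
    by apply: ler_wpM2l; [exact: ltW | rewrite mulrC (utility_slope hu) // ltW].
  (* The 1 is the range of [utility_slope]; [k0] keeps [k0 + h] nonnegative. *)
  exists C, (Num.min 1 k0); split.
  + by rewrite mulr_gt0.
  + by rewrite lt_min ltr01.
  + by rewrite ge_min lexx orbT.
  move=> h; rewrite ltrNl !lt_min => /andP[/andP[h1 h2] /andP[h3 h4]] hn0.
  have [hlt|hgt|/eqP] := ltgtP h 0; last by rewrite (negbTE hn0).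
  + have := Ch (k0 + h) (- h) ltac:(lra) ltac:(lra); rewrite addrK => {}Ch.
    rewrite ler_ndivlMr //; lra.
  + have := Ch k0 h ltac:(lra) ltac:(lra) => {}Ch.
    by rewrite ler_pdivlMr.
- move=> a b a0 ab.
  have Fa0 := production_gt0 hF a0.
  have Vb0 : 0 <= value F u rho b.
    by apply: (value_ge0 hF hu hrho heps0 hgrowth); rewrite (le_trans (ltW a0)).
  have aab : (`[a, b] `*` `[a, b]) (a, a) by split; rewrite /= in_itv /= lexx.
  have properab := globally_properfilter aab.
  (* For [x <= y], [value_delay] and [expR z >= 1 + z] bound the increment of the value by
     [rho * tau] times its value at [y], which is at most its value at [b]; moreover
     [tau <= (y - x) / F a]. *)
  apply: (@klipschitzW _ _ _ (rho * value F u rho b / F a)).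
  move=> [x y] [] /=; rewrite !in_itv /=.
  wlog xy : x y / x <= y => [H hx hy|/andP[ax xb] /andP[ay yb]].
    have [/H|/ltW/H] := leP x y; first exact.
    by move=> /(_ hy hx); rewrite [X in X <= _]distrC [X in _ <= _ * X]distrC.
  have x0 : 0 < x by exact: lt_le_trans ax.
  have h0 : 0 <= y - x by rewrite subr_ge0.
  have Fx0 := production_gt0 hF x0.
  have Fax := production_le hF ax.
  pose tau := (y - x) / F x.
  have tau0 : 0 <= tau by rewrite divr_ge0 // ltW.
  have taua : tau <= (y - x) / F a.
    by rewrite /tau ler_wpM2l // lef_pV2 // posrE.
  have := value_delay hF hu hrho heps0 hgrowth x0 h0; rewrite [x + _]addrC subrK -/tau.
  have Vy0 : 0 <= value F u rho y.
    by apply: (value_ge0 hF hu hrho heps0 hgrowth); rewrite (le_trans (ltW x0)).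
  have Vyb : value F u rho y <= value F u rho b.
    by move: yb; rewrite le_eqVlt => /orP[/eqP -> //|yb]; apply/ltW/incr; lra.
  have Vxy : value F u rho x <= value F u rho y.
    by move: xy; rewrite le_eqVlt => /orP[/eqP -> //|xy]; apply/ltW/incr; lra.
  move=> delay; rewrite distrC ger0_norm ?subr_ge0 // distrC ger0_norm //.
  have : (1 + - rho * tau) * value F u rho y <= expR (- rho * tau) * value F u rho y.
    by rewrite ler_wpM2r // expR_ge1Dx.
  have : rho * tau * value F u rho y <= rho * ((y - x) / F a) * value F u rho b.
    apply: ler_pM => //; first by rewrite mulr_ge0 // ltW.
    by rewrite ler_wpM2l // ltW.
  have -> : rho * value F u rho b / F a * (y - x) = rho * ((y - x) / F a) * value F u rho b by ring.
  lra.
Qed.
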